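(* Let $b\ge2$ be an integer, $\gamma\in(0,1)$, and let $\phi:\mathbb{R}\to\mathbb{R}$ be a $\mathbb{Z}$-periodic Lipschitz function. Then (1) $\omega$ is exact dimensional; (2) there is a constant $\alpha\in[0,1]$ such that for Lebesgue-a.e. $x\in[0,1]$, $m_x$ is exact dimensional and $\dim(m_x)=\alpha$; (3) $\dim(\omega)=1+\alpha$.
   Context: $\Lambda=\{0,\dots,b-1\}$, $\Sigma=\Lambda^{\mathbb{Z}_+}$, $\nu$ the uniform probability on $\Lambda$. For $\mathbf{j}\in\Sigma$ and $x\in[0,1]$, $S(x,\mathbf{j})=\sum_{n\ge1}\gamma^{n-1}\phi\big(\frac{x+j_1+j_2b+\cdots+j_nb^{n-1}}{b^n}\big)$, and $m_x$ is the image of $\nu^{\mathbb{Z}_+}$ under $\mathbf{j}\mapsto S(x,\mathbf{j})$. $\omega$ is the SRB measure of $T(x,y)=(bx\bmod1,\gamma y+\phi(x))$ on $[0,1)\times\mathbb{R}$, i.e. the ergodic probability measure such that Lebesgue-a.e. point $z$ has $\frac1n\sum_{k<n}\delta_{T^kz}\to\omega$ weakly; equivalently $\omega=\int_{[0,1)}\delta_x\times m_x\,dx$. A probability measure $\mu$ is exact dimensional if for some $\beta$, $\lim_{r\to0}\log\mu(B(z,r))/\log r=\beta$ for $\mu$-a.e. $z$; then $\dim(\mu)=\beta$. *)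

(* Defs.v *)
From HB Require Import structures.
From mathcomp Require Import all_boot all_order all_algebra.
From mathcomp Require Import all_classical all_reals all_analysis.
Set Implicit Arguments. Unset Strict Implicit. Unset Printing Implicit Defensive.
Import Order.TTheory GRing.Theory Num.Theory.
Import numFieldNormedType.Exports.
Local Open Scope classical_set_scope.
Local Open Scope ring_scope.

Section Defs.
Variable R : realType.

Definition Zperiodic (phi : R -> R) := forall x, phi (x + 1) = phi x.

(* S(x, j) = sum_{n>=1} gamma^(n-1) phi((x + j_1 + j_2 b + ... + j_n b^(n-1))/b^n),
   where the digit sequence j = (j_1, j_2, ...) is given as j : nat -> nat with
   j k = j_(k+1).  The summation index k below is n - 1. *)
Definition Sfun (b : nat) (gamma : R) (phi : R -> R) (x : R) (j : nat -> nat) : R :=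
  limn (series (fun k : nat =>
    gamma ^+ k * phi ((x + \sum_(i < k.+1) (j i)%:R * (b%:R) ^+ i) / (b%:R) ^+ k.+1))).

(* (J k)_k is an i.i.d. sequence of uniform random variables on
   Lambda = {0,...,b-1} over the probability space (Omega, P), i.e.
   the law of J is nu^{Z_+}: all cylinder sets have the product probability. *)
Definition iid_uniform_digits d (Omega : measurableType d)
    (P : probability Omega R) (b : nat) (J : nat -> Omega -> nat) :=
  (forall k w, J k w < b)%N /\
  (forall k (j : nat), measurable (J k @^-1` [set j])) /\
  (forall (n : nat) (w : nat -> nat), (forall k, k < n -> w k < b)%N ->
     P [set o | forall k, (k < n)%N -> J k o = w k] = ((b%:R : R) ^- n)%:E).

Definition m_meas d (Omega : measurableType d) (P : probability Omega R)
    (J : nat -> Omega -> nat) (b : nat) (gamma : R) (phi : R -> R) (x : R) :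
    set R -> \bar R :=
  fun A => P [set o | A (Sfun b gamma phi x (fun k => J k o))].

Definition omega_meas d (Omega : measurableType d) (P : probability Omega R)
    (J : nat -> Omega -> nat) (b : nat) (gamma : R) (phi : R -> R) :
    set (R * R) -> \bar R :=
  fun A => (\int[lebesgue_measure]_(x in `[0%R, 1%R[)
              m_meas P J b gamma phi x [set y | A (x, y)])%E.

(* a property holds mu-almost everywhere (mu given as a set function on the
   sigma-algebra described by `meas`) *)
Definition ae_wrt {T : Type} (meas : set T -> Prop) (mu : set T -> \bar R)
    (Q : T -> Prop) :=
  exists N, meas N /\ mu N = 0%E /\ forall z, ~ N z -> Q z.

Definition local_dim_is {T : pseudoMetricType R} (mu : set T -> \bar R)
    (z : T) (beta : R) :=
  (fun r : R => ln (fine (mu (ball z r))) / ln r) @ 0^'+ --> beta.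

Definition exact_dim_with {T : pseudoMetricType R} (meas : set T -> Prop)
    (mu : set T -> \bar R) (beta : R) :=
  ae_wrt meas mu (fun z => local_dim_is mu z beta).

Definition exact_dimensional {T : pseudoMetricType R} (meas : set T -> Prop)
    (mu : set T -> \bar R) :=
  exists beta, exact_dim_with meas mu beta.

End Defs.

(* Main.v *)
Require Import Defs.
From HB Require Import structures.
From mathcomp Require Import all_boot all_order all_algebra.
From mathcomp Require Import all_classical all_reals all_analysis.
From mathcomp Require Import measurable_realfun.
From mathcomp Require Import ring lra zify.
Set Implicit Arguments. Unset Strict Implicit. Unset Printing Implicit Defensive.
Import Order.TTheory GRing.Theory Num.Theory.
Import numFieldNormedType.Exports.
Local Open Scope classical_set_scope.
Local Open Scope ring_scope.

(* Put y = x + v, where v < b^n has the base-b digits j_1, ..., j_n. By periodicity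
   the n-th partial sum of S(x, j) is a b^n-periodic function of y, and
   m_x(B(S(x, j), gamma^n)) is comparable to b^-n cnt_n(y), where cnt_n(y) counts the
   v' < b^n whose partial sum at x + v' is O(gamma^n)-close to the one at y.
   Moving one step along the orbit of (x, j) divides y by b.

   The ratio of cnt_N to the product of the multiplicities of the blocks of a
   decomposition of [0, N) has mean at most 1 over v, and up to subexponential
   factors the decomposition may depend on v. Let betas
   be the infimum of the beta such that almost surely cnt_n <= beta^n for some
   arbitrarily large n. As in proofs of Kingman's theorem, filling most of [0, N)
   with blocks satisfying cnt_n <= beta^n yields limsup cnt_N^(1/N) <= betas almost
   surely, for every x. The reverse bound, for almost every x, is a zero-one law:
   S is Lipschitz in x and the inverse branches of x |-> b x contract, so
   events at distant times are nearly independent. Hence m_x has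
   dimension ln(betas / b) / ln gamma.

   Finally |S(x, j) - S(x', j)| <= L |x - x'|, so that omega(B((x, y), r)) is comparable
   to r m_x(B(y, r)), up to changing r by a constant factor. *)

(** * Periodic functions and averages over base-b digits *)

(** Closeness of partial sums is not transitive, so each triangle inequality enlarges the constant
    [c] in [cnt c n]. The upper bound is proved for the small constant [c_out] and the lower bound
    for the larger [c_blk + 1], against one [betas] defined with [c_blk] in between. Nothing is lost
    in the limit: a ball of radius gamma^n is compared from above with [cnt] at scale n and from
    below with [cnt] at scale n + p, for a fixed p.

    Blocks can fill most of [0, N) only if bad positions are rare up to an exponentially small
    probability, from every starting point x. Hence [valid] bounds averages over finitely many
    digits, uniformly in x. It also allows a delay of q digits before a block is examined: this
    contracts the dependence on x by b^-q, so that bad blocks seen from one x are seen from all x,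
    at the cost of 1 in the constant. *)

Section periodic_sums.
Variable R : realType.
Implicit Types (f : R -> R) (x y : R).

Definition nat_periodic (p : nat) f := forall y, f (y + p%:R) = f y.

Lemma periodicM p f m y : nat_periodic p f -> f (y + (m * p)%:R) = f y.
Proof.
move=> fp; elim: m y => [|m IH] y; first by rewrite mul0n addr0.
by rewrite mulSn natrD addrA IH fp.
Qed.

Lemma periodic_dvd p q f : (p %| q)%N -> nat_periodic p f -> nat_periodic q f.
Proof. by move=> /dvdnP[m ->] fp y; rewrite periodicM. Qed.

Lemma sum_periodic_shift p f u x : nat_periodic p f ->
  \sum_(0 <= v < p) f (x + u%:R + v%:R) = \sum_(0 <= v < p) f (x + v%:R).
Proof.
move=> fp; elim: u x => [|u IH] x; first by under eq_bigr do rewrite addr0.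
under eq_bigr do rewrite -natr1 (addrC u%:R) addrA.
rewrite IH; case: p fp {IH} => [|p] fp; first by rewrite !big_nil.
rewrite big_nat_recr // big_nat_recl //= addr0 addrC.
congr (_ + _); first by rewrite -(fp x) -natr1 -addrA; congr (f (_ + _)); lra.
by apply: eq_bigr => i _; rewrite -natr1; congr f; lra.
Qed.

Lemma sum_nat_mul_split p q (F : nat -> R) :
  \sum_(0 <= v < p * q) F v =
  \sum_(0 <= i < p) \sum_(0 <= j < q) F (i + p * j)%N.
Proof.
rewrite exchange_big_nat /= mulnC big_nat_mul; apply: eq_big_nat => j _.
rewrite -{1}(add0n (j * p)%N) big_addn mulSn addnK.
by apply: eq_bigr => i _; rewrite mulnC.
Qed.

End periodic_sums.

Section averages.
Variables (R : realType) (b : nat).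
Hypothesis b_gt0 : (0 < b)%N.
Implicit Types (f g : R -> R) (x y : R).

(** The expectation of f(x + v) when the m digits of v are independent and uniform. *)
Definition avg (m : nat) f x : R :=
  (b%:R ^+ m)^-1 * \sum_(0 <= v < b ^ m) f (x + v%:R).

Let bm_gt0 m : 0 < (b%:R : R) ^+ m.
Proof. by rewrite exprn_gt0 // ltr0n. Qed.
Let bm_neq0 m : (b%:R : R) ^+ m != 0.
Proof. by rewrite gt_eqF. Qed.

Let mean_cst m (c : R) : (b%:R ^+ m)^-1 * \sum_(0 <= v < b ^ m) c = c.
Proof. by rewrite sumr_const_nat subn0 -[_ *+ (b ^ m)]mulr_natl natrX mulKf. Qed.

(** Conditioning on the first m digits: after them the orbit sits at y / b^m, and the later digits
    act on that point as the first ones did on x. *)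
Lemma avg_split m n f x :
  avg (m + n) f x =
  avg m (fun y => avg n (fun z => f (z * b%:R ^+ m)) (y / b%:R ^+ m)) x.
Proof.
rewrite /avg expnD sum_nat_mul_split exprD invfM -mulrA; congr (_ * _).
rewrite mulr_sumr; apply: eq_bigr => i _; congr (_ * _).
apply: eq_bigr => j _; rewrite mulrDl divfK //; congr f.
by rewrite natrD natrM natrX -addrA [j%:R * _]mulrC.
Qed.

Lemma avg_scale m n f x :
  avg (m + n) (fun y => f (y / b%:R ^+ m)) x =
  avg m (fun y => avg n f (y / b%:R ^+ m)) x.
Proof.
rewrite avg_split /avg; congr (_ * _); apply: eq_bigr => i _; congr (_ * _).
by apply: eq_bigr => j _; rewrite mulfK.
Qed.

Lemma ler_avg m f g x : (forall v, (v < b ^ m)%N -> f (x + v%:R) <= g (x + v%:R)) ->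
  avg m f x <= avg m g x.
Proof.
move=> fg; rewrite /avg ler_wpM2l ?invr_ge0 ?(ltW (bm_gt0 _)) //.
rewrite big_nat [X in _ <= X]big_nat.
by apply: ler_sum => i /andP[_ /fg].
Qed.

Lemma avg_cst m (c : R) x : avg m (fun=> c) x = c.
Proof. exact: mean_cst. Qed.

Lemma avg_ge0 m f x : (forall y, 0 <= f y) -> 0 <= avg m f x.
Proof. by move=> f0; rewrite -(avg_cst m 0 x); apply: ler_avg. Qed.

Lemma avgD m f g x : avg m (fun y => f y + g y) x = avg m f x + avg m g x.
Proof. by rewrite /avg big_split mulrDr. Qed.

Lemma avgM m f (c : R) x : avg m (fun y => c * f y) x = c * avg m f x.
Proof. by rewrite /avg -mulr_sumr mulrCA. Qed.

Lemma avg_sum m n (F : nat -> R -> R) x :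
  avg m (fun y => \sum_(0 <= i < n) F i y) x = \sum_(0 <= i < n) avg m (F i) x.
Proof. by rewrite /avg exchange_big_nat mulr_sumr. Qed.

(** A function of period b^m reads only the first m digits. *)
Lemma avg_widen m n f x : nat_periodic (b ^ m) f -> avg (m + n) f x = avg m f x.
Proof.
move=> fp; rewrite avg_split /avg; congr (_ * _); apply: eq_bigr => i _.
under eq_bigr do rewrite mulrDl divfK // -natrX -natrM periodicM //.
exact: mean_cst.
Qed.

Lemma inv_branch_itv m v x : (v < b ^ m)%N -> 0 <= x <= 1 ->
  0 <= (x + v%:R) / b%:R ^+ m <= 1.
Proof.
move=> vm /andP[x0 x1]; rewrite divr_ge0 ?addr_ge0 ?ler0n ?(ltW (bm_gt0 m)) //=.
rewrite ler_pdivrMr // mul1r.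
move: vm; rewrite -(ler_nat R) -natr1 natrX; lra.
Qed.

(* Digit blocks of length [l] are independent, so a product of functions of
   disjoint blocks is averaged one block at a time. *)
Lemma avg_prod_blocks l (B : R) g I x : 0 <= B -> (forall y, 0 <= g y) ->
  nat_periodic (b ^ l) g -> (forall y, 0 <= y <= 1 -> avg l g y <= B) ->
  0 <= x <= 1 ->
  avg (I * l) (fun y => \prod_(0 <= i < I) g (y / b%:R ^+ (i * l))) x <= B ^+ I.
Proof.
move=> B0 g0 gp gB; elim: I x => [|I IH] x x01.
  by rewrite mul0n /avg big_nat1 big_nil expr0 invr1 mulr1.
rewrite mulSn avg_split exprSr.
apply: (@le_trans _ _ (avg l (fun y => B ^+ I * g y) x)); last first.
  by rewrite avgM ler_wpM2l ?exprn_ge0 ?gB.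
apply: ler_avg => v vl; rewrite -[leRHS]mulrC.
rewrite (_ : avg _ _ _ = avg (I * l) (fun y => g (x + v%:R) *
   \prod_(0 <= i < I) g (y / b%:R ^+ (i * l))) ((x + v%:R) / b%:R ^+ l)).
  by rewrite avgM ler_wpM2l // IH // inv_branch_itv.
rewrite /avg; congr (_ * _); apply: eq_bigr => u _.
rewrite big_nat_recl // mul0n expr0 divr1 mulrDl divfK // -natrX -natrM periodicM //.
congr (_ * _); apply: eq_bigr => i _; congr g.
by rewrite mulSn exprD natrM natrX invfM mulrA mulrDl mulfK.
Qed.

End averages.

(** * Partial sums and their multiplicities *)

Record skew_data (R : realType) := SkewData {
  base : nat;
  rate : R;
  forcing : R -> R;
  forcing_sup : R;
  forcing_lip : R;
  base_ge2 : (2 <= base)%N;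
  rate01 : 0 < rate < 1;
  forcing_per : Zperiodic forcing;
  forcing_supP : forall y, `|forcing y| <= forcing_sup;
  forcing_lipP : forall x y, `|forcing x - forcing y| <= forcing_lip * `|x - y|
}.

Section partial_sums.
Variables (R : realType) (w : skew_data R).
Local Notation b := (base w).
Local Notation gamma := (rate w).
Local Notation phi := (forcing w).
Local Notation K := (forcing_sup w).
Local Notation Lam := (forcing_lip w).
Implicit Types (x y z c : R) (n k v : nat).

(* By periodicity of [phi], the n-th partial sum of S(x, j) only depends on
   the integer v = j_1 + j_2 b + ... + j_n b^(n-1); it is [partS n (x + v)], and
   the k-th iterate of (x, j) under the inverse of the expanding map becomes
   division by [b ^ k]. *)
Definition partS n y : R := \sum_(0 <= k < n) gamma ^+ k * phi (y / b%:R ^+ k.+1).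

Definition tail_bound : R := K / (1 - gamma).

Definition partS_close c n y y' := `|partS n y - partS n y'| <= c * gamma ^+ n.

Definition cnt c n y : R := \sum_(0 <= v < b ^ n) (partS_close c n (y + v%:R) y)%:R.

Lemma base_gt0 : (0 < b)%N.
Proof. exact: leq_trans (base_ge2 w). Qed.

Lemma baseX_gt0 n : 0 < (b%:R : R) ^+ n.
Proof. by rewrite exprn_gt0 // ltr0n base_gt0. Qed.

Lemma baseX_neq0 n : (b%:R : R) ^+ n != 0.
Proof. by rewrite gt_eqF // baseX_gt0. Qed.

Lemma rate_gt0 : 0 < gamma. Proof. by case/andP: (rate01 w). Qed.
Lemma rate_lt1 : gamma < 1. Proof. by case/andP: (rate01 w). Qed.

Lemma rateX_gt0 n : 0 < gamma ^+ n. Proof. by rewrite exprn_gt0 ?rate_gt0. Qed.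

Lemma forcing_natD y m : phi (y + m%:R) = phi y.
Proof. by elim: m => [|m IH]; rewrite ?addr0 // -natr1 addrA forcing_per. Qed.

Lemma forcing_sup_ge0 : 0 <= K.
Proof. exact: le_trans (normr_ge0 _) (forcing_supP w 0). Qed.

Lemma forcing_lip_ge0 : 0 <= Lam.
Proof.
by have := le_trans (normr_ge0 _) (forcing_lipP w 1 0); rewrite subr0 normr1 mulr1.
Qed.

Lemma tail_bound_ge0 : 0 <= tail_bound.
Proof. by rewrite divr_ge0 ?forcing_sup_ge0 // subr_ge0 ltW ?rate_lt1. Qed.

Lemma partS_periodic n : nat_periodic (b ^ n)%N (partS n).
Proof.
move=> y; apply: eq_big_nat => k /andP[_ kn]; congr (_ * _).
rewrite -(subnK kn) expnD natrM !natrX mulrDl mulfK ?baseX_neq0 //.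
by rewrite -[_ ^+ (n - _)]natrX forcing_natD.
Qed.

Lemma partS_add n m y : partS (n + m) y = partS n y + gamma ^+ n * partS m (y / b%:R ^+ n).
Proof.
rewrite /partS (@big_cat_nat _ _ _ n) ?leq_addr //=; congr (_ + _).
rewrite -{1}(add0n n) big_addn addKn mulr_sumr; apply: eq_bigr => k _.
by rewrite mulrA -exprD (addnC k n) -addnS [_ ^+ (n + k.+1)]exprD invfM !mulrA.
Qed.

Lemma partS_bound n y : `|partS n y| <= tail_bound.
Proof.
have r1 : 0 < 1 - gamma by rewrite subr_gt0 rate_lt1.
suff : `|partS n y| <= tail_bound * (1 - gamma ^+ n).
  move=> /le_trans; apply; rewrite ler_piMr ?tail_bound_ge0 //.
  by rewrite gerBl ltW ?rateX_gt0.
elim: n => [|n IH]; first by rewrite /partS big_nil normr0 expr0 subrr mulr0.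
rewrite /partS big_nat_recr //=; apply: le_trans (ler_normD _ _) _.
apply: le_trans (lerD IH (_ : _ <= gamma ^+ n * K)) _.
  rewrite normrM ger0_norm ?(ltW (rateX_gt0 n)) // ler_wpM2l ?(ltW (rateX_gt0 n)) //.
  exact: forcing_supP.
suff -> : K = tail_bound * (1 - gamma) by rewrite exprS le_eqVlt; apply/orP/or_introl/eqP; ring.
by rewrite /tail_bound divfK ?gt_eqF.
Qed.

Lemma partS_lip n x y : `|partS n x - partS n y| <= Lam * `|x - y|.
Proof.
have L0 : 0 <= Lam * `|x - y| by rewrite mulr_ge0 ?forcing_lip_ge0.
(* The k-th term has Lipschitz constant at most Lam * 2^-(k+1), because gamma^k <= 1 and b >= 2. *)
suff : `|partS n x - partS n y| <= Lam * `|x - y| * (1 - 2^-1 ^+ n).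
  move=> /le_trans; apply; rewrite ler_piMr // gerBl exprn_ge0 //.
elim: n => [|n IH]; first by rewrite /partS !big_nil subrr normr0 expr0 subrr mulr0.
rewrite /partS !big_nat_recr //= opprD addrACA; apply: le_trans (ler_normD _ _) _.
apply: le_trans (lerD IH (_ : _ <= Lam * `|x - y| * 2^-1 ^+ n.+1)) _; last first.
  by rewrite -mulrDr exprS le_eqVlt; apply/orP/or_introl/eqP; field.
rewrite -mulrBr normrM ger0_norm ?(ltW (rateX_gt0 n)) //.
apply: (@le_trans _ _ (1 * (Lam * (`|x - y| * 2^-1 ^+ n.+1)))); last by rewrite mul1r mulrA.
apply: ler_pM => //; first exact: ltW (rateX_gt0 n).
  by rewrite exprn_ile1 // ltW ?rate_gt0 ?rate_lt1.
apply: le_trans (forcing_lipP _ _ _) _; apply: ler_wpM2l; first exact: forcing_lip_ge0.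
rewrite -mulrBl normrM; apply: ler_wpM2l => //.
rewrite ger0_norm ?invr_ge0 ?(ltW (baseX_gt0 _)) // exprVn lef_pV2 ?posrE ?baseX_gt0 ?exprn_gt0 //.
by rewrite lerXn2r ?nnegrE // ler_nat base_ge2.
Qed.

(** Both points move by the same amount, which changes each partial sum by at most half of gamma^n;
    hence the loss of 1 in the constant. *)
Lemma close_lip c n x y x' y' : 2 * Lam * `|x - x'| <= gamma ^+ n -> x - x' = y - y' ->
  partS_close c n x y -> partS_close (c + 1) n x' y'.
Proof.
move=> d e; rewrite /partS_close => cl.
have -> : partS n x' - partS n y' = (partS n x - partS n y) +
  ((partS n x' - partS n x) - (partS n y' - partS n y)) by ring.
apply: le_trans (ler_normD _ _) _; rewrite mulrDl mul1r lerD //.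
apply: le_trans (ler_normB _ _) _; apply: le_trans d.
apply: le_trans (lerD (partS_lip _ _ _) (partS_lip _ _ _)) _.
by rewrite distrC [`|y' - y|]distrC -e; lra.
Qed.

Lemma cnt_periodic c n : nat_periodic (b ^ n)%N (cnt c n).
Proof.
move=> y; apply: eq_bigr => v _; rewrite /partS_close partS_periodic.
by rewrite (_ : y + _ + _ = y + v%:R + (b ^ n)%:R) ?partS_periodic //; ring.
Qed.

Lemma cnt_shift c n x v :
  cnt c n (x + v%:R) = \sum_(0 <= u < b ^ n) (partS_close c n (x + u%:R) (x + v%:R))%:R.
Proof.
rewrite /cnt (sum_periodic_shift (f := fun y => (partS_close c n y (x + v%:R))%:R)) //.
by move=> y; rewrite /partS_close partS_periodic.
Qed.

Lemma cnt_ge1 c n y : 0 <= c -> 1 <= cnt c n y.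
Proof.
move=> c0; have := expn_gt0 b n; rewrite base_gt0 /= /cnt.
case: (b ^ n)%N => // m _; rewrite big_nat_recl // addr0 /partS_close subrr normr0.
by rewrite mulr_ge0 ?(ltW (rateX_gt0 n)) //= lerDl sumr_ge0.
Qed.

Lemma cnt_le c n y : cnt c n y <= b%:R ^+ n.
Proof.
have -> : (b%:R : R) ^+ n = \sum_(0 <= v < b ^ n) 1 by rewrite sumr_const_nat subn0 natrX.
by apply: ler_sum => v _; rewrite lern1 leq_b1.
Qed.

Lemma cnt_gt0 c n y : 0 <= c -> 0 < cnt c n y.
Proof. by move=> c0; apply: lt_le_trans ltr01 (cnt_ge1 _ _ c0). Qed.

Lemma cnt_ge0 c n y : 0 <= cnt c n y.
Proof. by rewrite sumr_ge0. Qed.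

(** Among the points counted on the right, keep those with the same first k digits as y: their first
    k terms cancel and the rest is rescaled by gamma^k. *)
Lemma cnt_scale c n k y : cnt c n (y / b%:R ^+ k) <= cnt c (k + n) y.
Proof.
rewrite {2}/cnt expnD sum_nat_mul_split.
have := expn_gt0 b k; rewrite base_gt0 /=; case e : (b ^ k)%N => [|m] // _.
rewrite big_nat_recl //; apply: (@le_trans _ _ (\sum_(0 <= j < b ^ n)
   (partS_close c (k + n) (y + (b ^ k * j)%:R) y)%:R)); last first.
  rewrite -[leLHS]addr0 lerD ?sumr_ge0 // => [|i _]; last by rewrite sumr_ge0.
  by rewrite e.
apply: ler_sum => j _; rewrite ler_nat.
have [h|//] := boolP (partS_close c n (y / b%:R ^+ k + j%:R) (y / b%:R ^+ k)).
have yj : (y + (b ^ k * j)%:R) / b%:R ^+ k = y / b%:R ^+ k + j%:R.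
  by rewrite natrM natrX mulrDl [_ * j%:R]mulrC mulfK ?baseX_neq0.
rewrite /partS_close !partS_add yj mulnC (periodicM _ _ (partS_periodic k)).
rewrite opprD addrACA subrr add0r.
by rewrite -mulrBr normrM gtr0_norm ?rateX_gt0 // exprD mulrCA ler_pM2l ?rateX_gt0 // [_ <= _]h.
Qed.

Lemma cnt_lip c n y y' : 2 * Lam * `|y - y'| <= gamma ^+ n -> cnt c n y <= cnt (c + 1) n y'.
Proof.
move=> d; apply: ler_sum => v _; rewrite ler_nat.
have [h|//] := boolP (partS_close c n (y + v%:R) y).
rewrite (close_lip _ _ h) //; last by ring.
by rewrite (_ : _ - _ = y - y') //; ring.
Qed.

(** The m values v that contribute have partial sums near z, so they are pairwise close with
    constant 2c. Each therefore has multiplicity at least m, and m terms of size at most 1/m add up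
    to at most 1. *)
Lemma sum_inv_cnt_le1 c n x z :
  \sum_(0 <= v < b ^ n) (`|z - partS n (x + v%:R)| <= c * gamma ^+ n)%R%:R
     / cnt (2 * c) n (x + v%:R) <= 1.
Proof.
pose I v := `|z - partS n (x + v%:R)| <= c * gamma ^+ n.
pose m : R := \sum_(0 <= v < b ^ n) (I v)%:R.
apply: (@le_trans _ _ (\sum_(0 <= v < b ^ n) (I v)%:R * m^-1)); last first.
  rewrite -mulr_suml -/m; have [->|m0] := eqVneq m 0; first by rewrite mul0r.
  by rewrite mulfV.
rewrite big_nat [X in _ <= X]big_nat; apply: ler_sum => v /andP[_ vn].
rewrite -/(I v); case Iv : (I v); last by rewrite !mul0r.
have m1 : 0 < m.
  rewrite /m big_mkord (bigD1 (Ordinal vn)) //= Iv ltr_pwDl // sumr_ge0 //.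
rewrite !mul1r lef_pV2 ?posrE //; last first.
  by rewrite cnt_gt0 // mulr_ge0 // -(pmulr_lge0 _ (rateX_gt0 n)); apply: le_trans Iv.
rewrite cnt_shift; apply: ler_sum => u _; rewrite ler_nat.
case Iu : (I u) => //; suff -> : partS_close (2 * c) n (x + u%:R) (x + v%:R) by [].
rewrite /partS_close (_ : _ - _ = (z - partS n (x + v%:R)) - (z - partS n (x + u%:R))); last by ring.
by apply: le_trans (ler_normB _ _) _; move: Iu Iv; rewrite /I; lra.
Qed.

(* Multiplicities are supermultiplicative in the mean. After splitting off a first
   block of length [n], the sum over the remaining digits is at most 1 by
   induction, and only the first blocks landing close to [z] contribute: by
   [sum_inv_cnt_le1] there are at most [cnt] of them. Since the coefficients [cf]
   have total mass at most 1, the length of the block may depend on [y]. *)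
Lemma sum_weight_le1 (c : R) (cf : nat -> R) (wt : nat -> R -> R) :
  0 <= c -> (forall n, 0 <= cf n) -> (forall N, \sum_(1 <= n < N.+1) cf n <= 1) ->
  (forall N y, 0 <= wt N y) -> (forall y, wt 0%N y <= 1) ->
  (forall N y, (0 < N)%N -> wt N y <= \sum_(1 <= n < N.+1)
      cf n / cnt (2 * (c + tail_bound)) n y * wt (N - n)%N (y / b%:R ^+ n)) ->
  forall N x z, \sum_(0 <= v < b ^ N)
     (`|z - partS N (x + v%:R)| <= c * gamma ^+ N)%R%:R * wt N (x + v%:R) <= 1.
Proof.
move=> c0 cf0 cf1 w0 w01 wrec N.
elim/ltn_ind: N => N IH x z; case: (posnP N) => [->|N0].
  rewrite expn0 big_nat1 -[leRHS]mulr1 ler_pM //.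
  by rewrite lern1 leq_b1.
set cc := 2 * _ in wrec.
apply: (@le_trans _ _ (\sum_(0 <= v < b ^ N) \sum_(1 <= n < N.+1)
   (`|z - partS N (x + v%:R)| <= c * gamma ^+ N)%R%:R *
   (cf n / cnt cc n (x + v%:R) * wt (N - n)%N ((x + v%:R) / b%:R ^+ n)))).
  by apply: ler_sum => v _; rewrite -mulr_sumr ler_wpM2l // wrec.
rewrite exchange_big_nat /=.
apply: le_trans (cf1 N); rewrite big_nat [X in _ <= X]big_nat.
apply: ler_sum => n /andP[n1 nN].
have {nN}nN : (n <= N)%N by [].
rewrite -{1}(subnKC nN) expnD sum_nat_mul_split.
rewrite -[leRHS]mulr1.
apply: le_trans (ler_wpM2l (cf0 n) (sum_inv_cnt_le1 (c + tail_bound) n x z)).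
rewrite mulr_sumr; apply: ler_sum => i _; rewrite -/cc.
set I := (`|z - partS n (x + i%:R)| <= _).
(* Removing the first n digits turns the problem for x and z into the one for x' and z', rescaled by
   gamma^n. *)
set x' := (x + i%:R) / b%:R ^+ n.
set z' := (z - partS n (x + i%:R)) / gamma ^+ n.
have := IH (N - n)%N _ x' z'; rewrite ltn_subrL n1 N0 => /(_ isT) IHn.
have ptE j : z - partS N (x + (i + b ^ n * j)%:R) =
    gamma ^+ n * (z' - partS (N - n) (x' + j%:R)).
  rewrite -{1}(subnKC nN) partS_add mulrBr /z' [gamma ^+ n * (_ / _)]mulrC divfK; last first.
    by rewrite gt_eqF ?rateX_gt0.
  rewrite natrD addrA mulnC (periodicM _ _ (partS_periodic n)) opprD addrA.
  by congr (_ - _ * partS _ _); rewrite /x' mulrDl natrM natrX mulfK ?baseX_neq0.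
have wtE j : cf n / cnt cc n (x + (i + b ^ n * j)%:R) *
     wt (N - n)%N ((x + (i + b ^ n * j)%:R) / b%:R ^+ n) =
   cf n / cnt cc n (x + i%:R) * wt (N - n)%N (x' + j%:R).
  rewrite natrD addrA mulnC (periodicM _ _ (cnt_periodic cc n)).
  by congr (_ * wt _ _); rewrite /x' mulrDl natrM natrX mulfK ?baseX_neq0.
pose J j := `|z' - partS (N - n) (x' + j%:R)| <= c * gamma ^+ (N - n).
have JE j : (`|z - partS N (x + (i + b ^ n * j)%:R)| <= c * gamma ^+ N) = J j.
  rewrite ptE normrM gtr0_norm ?rateX_gt0 // -{2}(subnKC nN) exprD mulrCA.
  by rewrite ler_pM2l ?rateX_gt0.
under eq_bigr do rewrite wtE JE mulrCA.
rewrite -mulr_sumr -/I mulrAC -mulrA.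
apply: ler_wpM2l; first exact: cf0.
rewrite mulrC -[leRHS]mulrC; apply: ler_wpM2l; first by rewrite invr_ge0 cnt_ge0.
(* A first block outside the enlarged window [I] cannot be completed to a sum close to z, since the
   remaining terms are bounded by [tail_bound]. *)
case nI : I => //; rewrite big1 // => j _; case Jj : (J j); last by rewrite mul0r.
suff: I by rewrite nI.
rewrite /I; have -> : z - partS n (x + i%:R) = gamma ^+ n * z'.
  by rewrite /z' mulrC divfK // gt_eqF ?rateX_gt0.
rewrite normrM gtr0_norm ?rateX_gt0 // mulrC ler_pM2r ?rateX_gt0 //.
have -> : z' = (z' - partS (N - n) (x' + j%:R)) + partS (N - n) (x' + j%:R) by ring.
apply: le_trans (ler_normD _ _) _; rewrite lerD ?partS_bound //; apply: le_trans Jj _.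
by rewrite ler_piMr // exprn_ile1 // ltW ?rate_gt0 ?rate_lt1.
Qed.

(** Write [cnt] as a sum over u and exchange sums: for each of the b^N values of u, [sum_weight_le1]
    with z the partial sum at x + u bounds the sum over v by 1. *)
Lemma cnt_weight_le1 (c : R) (cf : nat -> R) (wt : nat -> R -> R) :
  0 <= c -> (forall n, 0 <= cf n) -> (forall N, \sum_(1 <= n < N.+1) cf n <= 1) ->
  (forall N y, 0 <= wt N y) -> (forall y, wt 0%N y <= 1) ->
  (forall N y, (0 < N)%N -> wt N y <= \sum_(1 <= n < N.+1)
      cf n / cnt (2 * (c + tail_bound)) n y * wt (N - n)%N (y / b%:R ^+ n)) ->
  forall N x, avg b N (fun y => cnt c N y * wt N y) x <= 1.
Proof.
move=> c0 cf0 cf1 w0 w01 wrec N x.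
rewrite /avg ler_pdivrMl ?baseX_gt0 // mulr1.
under eq_bigr do rewrite cnt_shift mulr_suml.
rewrite exchange_big_nat /= -natrX.
have -> : ((b ^ N)%:R : R) = \sum_(0 <= v < b ^ N) 1 by rewrite sumr_const_nat subn0.
apply: ler_sum => u _.
exact: (sum_weight_le1 c0 cf0 cf1 w0 w01 wrec).
Qed.

End partial_sums.

(** * Frequency of bad positions along an orbit *)

Lemma sum_nat_shift n N (F : nat -> nat) :
  (\sum_(n <= k < N) F k = \sum_(0 <= k < N - n) F (k + n))%N.
Proof. by rewrite -{1}(add0n n) big_addn. Qed.

Section elementary.
Variable R : realType.
Implicit Types (x y : R).

Lemma bernoulli_ge x n : 0 <= x <= 1 -> 1 - n%:R * x <= (1 - x) ^+ n.
Proof.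
move=> /andP[x0 x1]; elim: n => [|n IH]; first by rewrite mul0r subr0.
rewrite exprS; apply: (@le_trans _ _ ((1 - x) * (1 - n%:R * x))); last first.
  by rewrite ler_wpM2l // subr_ge0.
rewrite -natr1 -subr_ge0 (_ : _ - _ = n%:R * (x * x)); last by ring.
by rewrite !mulr_ge0.
Qed.

Lemma expr_lt_eps x (e : R) : 0 <= x < 1 -> 0 < e -> exists n, x ^+ n < e.
Proof.
move=> /andP[x0 x1] e0.
have /cvgrPdist_lt/(_ _ e0)[n _ /(_ n (leqnn n))] : (x ^+ n) @[n --> \oo] --> (0 : R).
  by apply: cvg_expr; rewrite ger0_norm.
by rewrite sub0r normrN ger0_norm ?exprn_ge0 // => h; exists n.
Qed.

Lemma geometric_partial_sum x m n : 0 <= x < 1 -> (1 - x) * \sum_(m <= i < n) x ^+ i <= x ^+ m.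
Proof.
move=> /andP[x0 x1].
have [nm|mn] := leqP n m; first by rewrite big_geq // mulr0 exprn_ge0.
suff -> : (1 - x) * \sum_(m <= i < n) x ^+ i = x ^+ m - x ^+ n.
  by rewrite gerBl exprn_ge0.
rewrite mulr_sumr -[RHS]opprB -(telescope_sumr _ (ltnW mn)) -sumrN.
by apply: eq_bigr => i _; rewrite exprS; ring.
Qed.

Lemma half_expn_divn l : (0 < l)%N -> exists th : R, [/\ 0 < th, th < 1 &
  forall N, 2^-1 ^+ (N %/ l) <= 2 * th ^+ N].
Proof.
move=> l0; pose th : R := 1 - (2 * l%:R)^-1.
have l1 : 1 <= l%:R :> R by rewrite ler1n.
have i1 : 0 < (2 * l%:R : R)^-1 <= 2^-1.
  apply/andP; split; first by rewrite invr_gt0; lra.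
  rewrite lef_pV2 ?posrE; lra.
have tl : 2^-1 <= th ^+ l.
  apply: le_trans (bernoulli_ge _ _); last lra.
  have -> : l%:R * (2 * l%:R)^-1 = 2^-1 :> R by field; lra.
  lra.
exists th; split; [rewrite /th; lra|rewrite /th; lra|move=> N].
have t0 : 0 <= th <= 1 by rewrite /th; lra.
have t2 : 1 <= 2 * th ^+ (N %% l).
  suff : th ^+ l <= th ^+ (N %% l) by lra.
  by case/andP: t0 => ? ?; apply: ler_wiXn2l; rewrite // ltnW ?ltn_mod.
rewrite {2}(divn_eq N l) exprD mulrCA mulnC exprM.
apply: (@le_trans _ _ ((th ^+ l) ^+ (N %/ l))).
  by rewrite lerXn2r ?nnegrE ?exprn_ge0 //; case/andP: t0.
by rewrite ler_peMr // !exprn_ge0 //; case/andP: t0.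
Qed.

End elementary.

Section periodic_closure.
Variables (R : realType) (b : nat).
Hypothesis b_gt0 : (0 < b)%N.

Lemma nat_periodic_scale (T : Type) (f : R -> T) k m :
  (forall y, f (y + (b ^ m)%:R) = f y) ->
  forall y, f ((y + (b ^ (k + m))%:R) / b%:R ^+ k) = f (y / b%:R ^+ k).
Proof.
move=> fp y; rewrite mulrDl expnD natrM natrX [_ * (b ^ m)%:R]mulrC mulfK ?fp //.
by rewrite expf_neq0 // pnatr_eq0 -lt0n.
Qed.

Lemma nat_periodic_prod_blocks (g : R -> R) l I : nat_periodic (b ^ l) g ->
  nat_periodic (b ^ (I * l)) (fun y => \prod_(0 <= i < I) g (y / b%:R ^+ (i * l))).
Proof.
move=> g_per y; apply: eq_big_nat => i /andP[_ iI].
have -> : (I * l = i * l + ((I - i.+1) * l + l))%N.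
  by rewrite addnA -mulnDl -mulSnr; congr (_ * _)%N; lia.
rewrite (nat_periodic_scale (f := g)) // => z.
by rewrite (periodic_dvd _ g_per) // dvdn_exp2l // leq_addl.
Qed.

End periodic_closure.

Section frequency.
Variables (R : realType) (b : nat).
Hypothesis b_gt0 : (0 < b)%N.
(** [f] marks bad positions and reads M digits. It is rare after a delay of q digits, from every
    starting point; this uniformity replaces independence. *)
Variables (f : R -> bool) (q M p : nat) (del : R).
Hypothesis f_per : forall y, f (y + (b ^ M)%:R) = f y.
Hypothesis M_gt0 : (0 < M)%N.
Hypothesis f_rare : forall x, 0 <= x <= 1 ->
  avg b (q + M) (fun y => (f (y / b%:R ^+ q))%:R) x <= del.
Hypothesis del_small : 4 ^+ p * del <= 1.

(** A position with fewer than M digits left also counts, since a good block starting there may not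
    fit into [0, N). *)
Definition misses N (y : R) : nat :=
  \sum_(0 <= k < N) (f (y / b%:R ^+ k) || (N - k < M))%N.

Let l := (q + M)%N.

Let l_gt0 : (0 < l)%N. Proof. by rewrite addn_gt0 M_gt0 orbT. Qed.

Lemma misses_shift n N y : (n <= N)%N ->
  (misses (N - n) (y / b%:R ^+ n) <= misses N y)%N.
Proof.
move=> nN; rewrite {2}/misses (@big_cat_nat _ _ _ n) //=.
apply: leq_trans (leq_addl _ _); rewrite [leqRHS]sum_nat_shift /misses.
apply: eq_leq; apply: eq_bigr => k _.
by rewrite -mulrA -invfM -exprD (addnC k n) subnDA.
Qed.

Lemma misses_recl N y : f y || (N < M)%N -> (0 < N)%N ->
  misses N y = (misses N.-1 (y / b%:R)).+1.
Proof.
case: N => // N fy _; rewrite /misses big_nat_recl // expr0 divr1 subn0 fy add1n.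
congr _.+1; apply: eq_bigr => k _.
by rewrite exprS invfM mulrA subSS.
Qed.

(** Bad positions in one residue class modulo l. Each lies q digits into its own block of length l
    and reads up to the end of that block. One block is given up so that every r < l fits below
    N. *)
Let run N r (y : R) : nat :=
  (\sum_(0 <= i < (N %/ l).-1) f (y / b%:R ^+ (q + r + i * l)))%N.

(** At most 2l positions, near the two ends of [0, N), belong to no run. *)
Lemma misses_runs N y : (misses N y <= l.*2 + \sum_(0 <= r < l) run N r y)%N.
Proof.
set I := (N %/ l).-1.
have triv (m n : nat) (F : nat -> bool) : (\sum_(m <= k < n) F k <= n - m)%N.
  rewrite -[leqRHS]muln1 -sum_nat_const_nat; apply: leq_sum => i _.
  by case: (F i).
have [Nl|lN] := ltnP N l.
  apply: leq_trans (leq_addr _ _); apply: leq_trans (triv _ _ _) _.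
  by rewrite subn0 -addnn; lia.
have IlN : (I * l + l <= N)%N.
  rewrite -mulSnr /I prednK ?divn_gt0 //; exact: leq_trunc_div.
have NIl : (N < I * l + l.*2)%N.
  have := ltn_ceil N l_gt0; rewrite -addnn addnA -mulSnr -mulSnr /I prednK ?divn_gt0 //.
have qN : (q + I * l <= N - M)%N by move: IlN; rewrite {2}/l; lia.
rewrite /misses (@big_cat_nat _ _ _ q) //=; last by lia.
rewrite (@big_cat_nat _ _ _ (q + I * l) q) //=; [|by lia|by lia].
have -> : (\sum_(0 <= r < l) run N r y =
    \sum_(q <= k < q + I * l) (f (y / b%:R ^+ k) || (N - k < M)))%N.
  rewrite exchange_big_nat /= [RHS]sum_nat_shift addnC addnK big_nat_mul.
  rewrite -/I; apply: eq_big_nat => i /andP[_ iI].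
  rewrite [RHS]sum_nat_shift mulSn addnK.
  apply: eq_big_nat => r /andP[_ rl].
  have -> : (N - (r + i * l + q) < M)%N = false.
    have : (i.+1 * l <= I * l)%N by rewrite leq_mul2r iI orbT.
    by rewrite mulSn; lia.
  by rewrite orbF; congr (f (_ / _ ^+ _) : nat); lia.
rewrite addnCA [leqRHS]addnC leq_add2l.
apply: leq_trans (leq_add (triv _ _ _) (triv _ _ _)) _; lia.
Qed.

(** Exponential moment: each block contributes a factor of conditional mean at most 1 + 4^p del <=
    2. *)
Lemma avg_run N r x : (r < l)%N -> 0 <= x <= 1 ->
  avg b N (fun y => 4 ^+ (p * run N r y)) x <= 2 ^+ (N %/ l).-1.
Proof.
move=> rl x01; set I := (N %/ l).-1.
pose g (y : R) : R := 4 ^+ (p * f (y / b%:R ^+ q)).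
have g_per : nat_periodic (b ^ l) g.
  by move=> y; rewrite /g nat_periodic_scale.
pose h (y : R) : R := \prod_(0 <= i < I) g (y / b%:R ^+ (i * l)).
have hE y : 4 ^+ (p * run N r y) = h (y / b%:R ^+ r).
  rewrite /h /run -/I big_distrr /= expr_sum; apply: eq_bigr => i _.
  rewrite /g; congr (4 ^+ (p * f _)); rewrite -!mulrA -!invfM -!exprD.
  by congr (_ / _ ^+ _); lia.
have h_per : nat_periodic (b ^ (I * l)) h by exact: nat_periodic_prod_blocks.
have [I0|I0] := posnP I.
  rewrite (_ : (fun _ => _) = fun=> 1) ?avg_cst ?I0 //.
  by apply/funext => y; rewrite hE /h I0 big_nil.
have rIN : (r + I * l <= N)%N.
  have : (I * l + l <= N)%N.
    rewrite -mulSnr /I prednK ?leq_trunc_div //.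
    by move: I0; rewrite /I; case: (N %/ l)%N.
  lia.
rewrite (_ : (fun _ => _) = fun y => h (y / b%:R ^+ r)); last exact/funext.
rewrite -(subnKC rIN) avg_widen //; last first.
  by move=> y; rewrite nat_periodic_scale.
rewrite avg_scale // -[leRHS](avg_cst b_gt0 r _ x).
apply: ler_avg => // v vr.
apply: (@avg_prod_blocks _ _ b_gt0 l) => //; last exact: inv_branch_itv.
  by move=> y; rewrite exprn_ge0.
move=> y y01; apply: (@le_trans _ _ (avg b l (fun y => 1 + 4 ^+ p * (f (y / b%:R ^+ q))%:R) y)).
  apply: ler_avg => // u _; rewrite /g; case: (f _) => /=.
    by rewrite muln1 mulr1; lra.
  by rewrite muln0 mulr0; lra.
rewrite avgD avg_cst // avgM.
suff : 4 ^+ p * avg b l (fun y => (f (y / b%:R ^+ q))%:R) y <= 1 by lra.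
by apply: le_trans del_small; rewrite ler_wpM2l ?exprn_ge0 ?f_rare.
Qed.

(** Too many misses force p * run > I in some residue class, where I is the number of blocks. By
    Markov's inequality and [avg_run] this has probability at most 4^-I 2^I = 2^-I for each of the l
    classes. *)
Lemma misses_rare : exists C th : R, [/\ 0 <= C, 0 < th, th < 1 &
  forall N x, 0 <= x <= 1 ->
    avg b N (fun y => (N + p * l.*2 < p * misses N y)%N%:R) x <= C * th ^+ N].
Proof.
have [th [t0 t1 tP]] := half_expn_divn R l_gt0.
(* The 4 is a factor 2 from I = N %/ l - 1 times a factor 2 from [half_expn_divn]. *)
exists (l%:R * 4), th; split => // N x x01.
set I := (N %/ l).-1.
apply: (@le_trans _ _ (avg b N (fun y =>
  \sum_(0 <= r < l) (4 ^+ I)^-1 * 4 ^+ (p * run N r y)) x)).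
  apply: ler_avg => // v _; set y := x + v%:R.
  have s0 r : 0 <= (4 ^+ I)^-1 * 4 ^+ (p * run N r y) :> R.
    by rewrite mulr_ge0 ?invr_ge0 ?exprn_ge0.
  have [big_misses|_] := ltnP; last by rewrite sumr_ge0.
  have : (exists2 r, (r < l)%N & (I < p * run N r y)%N).
    apply/not_exists2P => small.
    have : (p * \sum_(0 <= r < l) run N r y <= I * l)%N.
      rewrite big_distrr /= mulnC -[l in (l * _)%N]subn0 -sum_nat_const_nat.
      rewrite big_nat [leqRHS]big_nat; apply: leq_sum => r /andP[_ rl].
      by case: (small r) => //; move/negP; rewrite -leqNgt.
    have := misses_runs N y.
    have : (I * l <= N)%N.
      by apply: leq_trans (leq_trunc_div N l); rewrite leq_mul2r leq_pred orbT.
    move: big_misses; set A := misses _ _; set B := (\sum_(_ <= _ < _) _)%N.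
    move=> h1 h2 h3 h4.
    have : (p * A <= p * (l.*2 + B))%N by rewrite leq_mul2l h3 orbT.
    by move: h1 h2 h4; rewrite mulnDr; lia.
  case=> r rl Ir; rewrite big_mkord (bigD1 (Ordinal rl)) //=.
  rewrite -[leLHS]addr0 lerD ?sumr_ge0 // ler_pdivlMl ?exprn_gt0 // mulr1.
  by rewrite ler_weXn2l ?ler1n // ltnW.
rewrite avg_sum.
apply: (@le_trans _ _ (\sum_(0 <= r < l) (4 ^+ I)^-1 * 2 ^+ I)).
  rewrite big_nat [leRHS]big_nat; apply: ler_sum => r /andP[_ rl].
  by rewrite avgM ler_wpM2l ?invr_ge0 ?exprn_ge0 // avg_run.
rewrite sumr_const_nat subn0 -[_ *+ l]mulr_natl -mulrA ler_wpM2l //.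
apply: (@le_trans _ _ (2 * 2^-1 ^+ (N %/ l))); last by have := tP N; lra.
have -> : (4 ^+ I)^-1 * 2 ^+ I = 2^-1 ^+ I :> R.
  rewrite -!exprVn -exprMn; congr (_ ^+ _); lra.
rewrite /I; case: (N %/ l)%N => [|m] /=; first by rewrite !expr0; lra.
by rewrite exprS mulrA divff ?mul1r //; lra.
Qed.

End frequency.

(** * Growth rate of the multiplicities *)

Section good_scales.
Variables (R : realType) (w : skew_data R).
Local Notation b := (base w).
Local Notation gamma := (rate w).
Local Notation D := (tail_bound w).
Implicit Types (x y c beta : R) (n k L M q : nat).

Definition good c beta L M y : bool :=
  has (fun n => cnt w c n y <= beta ^+ n) (index_iota L M.+1).

Lemma goodP c beta L M y :
  reflect (exists2 n, (L <= n <= M)%N & cnt w c n y <= beta ^+ n) (good c beta L M y).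
Proof.
apply: (iffP hasP) => -[n]; rewrite ?mem_index_iota ?ltnS => nLM cn.
  by exists n => //; rewrite -ltnS.
by exists n => //; rewrite mem_index_iota ltnS.
Qed.

Lemma good_periodic_ge c beta L M M' y : (M <= M')%N ->
  good c beta L M (y + (b ^ M')%:R) = good c beta L M y.
Proof.
move=> MM'.
have per n : (n <= M)%N -> cnt w c n (y + (b ^ M')%:R) = cnt w c n y.
  move=> nM; rewrite (periodic_dvd _ (cnt_periodic w c n)) // dvdn_exp2l //.
  exact: leq_trans MM'.
by apply/goodP/goodP => -[n /andP[Ln nM]] cn; exists n; rewrite ?Ln ?nM //;
  move: cn; rewrite per.
Qed.

Lemma good_periodic c beta L M y : good c beta L M (y + (b ^ M)%:R) = good c beta L M y.
Proof. exact: good_periodic_ge. Qed.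

Lemma good_widen c beta L M M' y : (M <= M')%N -> good c beta L M y -> good c beta L M' y.
Proof.
move=> MM /goodP[n /andP[Ln nM] cn]; apply/goodP; exists n => //.
by rewrite Ln (leq_trans nM).
Qed.

Lemma good_close c beta L M y y' : 2 * forcing_lip w * `|y' - y| <= gamma ^+ M ->
  good (c + 1) beta L M y -> good c beta L M y'.
Proof.
move=> d /goodP[n nLM cn]; apply/goodP; exists n => //; apply: le_trans cn.
apply: cnt_lip; apply: le_trans d _; apply: ler_wiXn2l.
- exact/ltW/rate_gt0.
- exact/ltW/rate_lt1.
by case/andP: nLM.
Qed.

(* The outer and block multiplicity constants: an interval of radius
   [c_out + D] must fit into half of one of radius [c_blk]. *)
Definition c_out : R := 1 + 2 * D.
Definition c_blk : R := 2 * (c_out + D).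

Lemma c_out_ge0 : 0 <= c_out.
Proof. by rewrite addr_ge0 // mulr_ge0 // tail_bound_ge0. Qed.

Lemma c_blk_ge2 : 2 <= c_blk.
Proof. rewrite /c_blk /c_out; have := tail_bound_ge0 w; lra. Qed.

Lemma c_blk_ge0 : 0 <= c_blk.
Proof. exact: le_trans c_blk_ge2. Qed.

(** Finite, uniform form of: almost surely the multiplicity is at most beta^n at some arbitrarily
    large scale n. *)
Definition valid beta := forall L del, 0 < del -> exists M q, (L <= M)%N /\
  forall x, 0 <= x <= 1 ->
    avg b (q + M) (fun y => (~~ good c_blk beta L M (y / b%:R ^+ q))%:R) x <= del.

Lemma valid_base : valid b%:R.
Proof.
move=> L del del0; exists L, 0%N; split => // x _; apply: le_trans (ltW del0).
rewrite (_ : (fun _ => _) = fun=> 0) ?avg_cst ?base_gt0 //.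
apply/funext => y; case: goodP => // -[]; exists L; rewrite ?leqnn //.
exact: cnt_le.
Qed.

(** Sums [sum_inv_cnt_le1] over a grid; c >= 2 makes the windows of radius c / 2 * gamma^n cover a
    mesh of gamma^n. *)
Lemma sum_inv_cnt c n x : 2 <= c ->
  \sum_(0 <= v < b ^ n) (cnt w c n (x + v%:R))^-1 <= (2 * D + 1) * (gamma ^+ n)^-1.
Proof.
move=> c2; have g0 := rateX_gt0 w n; have D0 := tail_bound_ge0 w.
have g1 : 1 <= (gamma ^+ n)^-1.
  rewrite invf_ge1 //; apply: exprn_ile1; first exact/ltW/rate_gt0.
  exact/ltW/rate_lt1.
(* The points [- D + i * gamma ^+ n], for [i < m], form a grid of mesh [gamma ^+ n]
   on the range of [partS n]. *)
pose m := (Num.trunc (2 * D / gamma ^+ n)).+1.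
have mle : m%:R <= (2 * D + 1) * (gamma ^+ n)^-1.
  rewrite /m -addn1 natrD [leRHS]mulrDl mul1r lerD // truncn_le.
  by rewrite divr_ge0 ?(ltW g0) // mulr_ge0.
apply: le_trans mle.
pose z i := - D + i%:R * gamma ^+ n.
apply: (@le_trans _ _ (\sum_(0 <= v < b ^ n) \sum_(0 <= i < m)
   (`|z i - partS w n (x + v%:R)| <= c / 2 * gamma ^+ n)%R%:R
     / cnt w (2 * (c / 2)) n (x + v%:R))).
  apply: ler_sum => v _; set s := partS w n _.
  have c0 : 0 <= c by lra.
  have := partS_bound w n (x + v%:R); rewrite -/s ler_norml => /andP[sD1 sD2].
  pose i := Num.trunc ((s + D) / gamma ^+ n).
  have i0 : 0 <= (s + D) / gamma ^+ n by rewrite divr_ge0 ?(ltW g0) //; lra.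
  have im : (i < m)%N.
    rewrite ltnS; apply: le_truncn; rewrite ler_pM2r ?invr_gt0 //; lra.
  have /andP[] := truncn_itv i0; rewrite -/i ler_pdivlMr // ltr_pdivrMr //.
  rewrite -addn1 natrD mulrDl mul1r => i1 i2.
  rewrite big_mkord (bigD1 (Ordinal im)) //=.
  have -> : (`|z i - s| <= c / 2 * gamma ^+ n) = true.
    apply: (@le_trans _ _ (1 * gamma ^+ n)); last by rewrite ler_wpM2r ?(ltW g0) //; lra.
    by rewrite ler_norml /z; lra.
  rewrite mul1r (_ : 2 * (c / 2) = c); last by field.
  rewrite lerDl sumr_ge0 // => j _; rewrite mulr_ge0 // invr_ge0 cnt_ge0 //.
rewrite exchange_big_nat /= -[m in leRHS]subn0 -sumr_const_nat.
by apply: ler_sum => i _; exact: sum_inv_cnt_le1.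
Qed.

(** This is what bounds the dimension by 1. By [sum_inv_cnt], a multiplicity at most beta^n has
    probability at most C (beta / (b gamma))^n. If beta < b gamma, these add up to at most 1/4 over
    n >= L, while validity would make good blocks have probability at least 3/4. *)
Lemma valid_ge beta : 0 < beta -> valid beta -> b%:R * gamma <= beta.
Proof.
move=> beta0 vb; rewrite leNgt; apply/negP => small.
have g0 := rate_gt0 w; have D0 := tail_bound_ge0 w.
have bb0 : 0 < (b%:R : R) by rewrite ltr0n base_gt0.
have bg0 : 0 < b%:R * gamma by rewrite mulr_gt0.
pose u := beta / (b%:R * gamma).
have u01 : 0 <= u < 1.
  by rewrite divr_ge0 ?(ltW beta0) ?(ltW bg0) //= ltr_pdivrMr // mul1r.
pose C := 2 * D + 1.
have C0 : 0 < C by rewrite /C; lra.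
have [L uL] : exists L, u ^+ L < (1 - u) / (4 * C).
  by apply: expr_lt_eps => //; rewrite divr_gt0 //; [case/andP: u01 => _; lra|lra].
have [|M [q [LM /(_ 0)]]] := vb L (4^-1); first by lra.
rewrite lexx ler01 => /(_ isT); set bad := avg _ _ _ _ => badle.
pose G n y : R := (cnt w c_blk n y <= beta ^+ n)%R%:R.
have Gavg n x : (n <= M)%N -> avg b M (G n) x <= C * u ^+ n.
  move=> nM; rewrite -(subnKC nM) avg_widen ?base_gt0 //; last first.
    by move=> y; rewrite /G cnt_periodic.
  apply: (@le_trans _ _ (avg b n (fun y => beta ^+ n * (cnt w c_blk n y)^-1) x)).
    apply: ler_avg => [|v _]; first exact: base_gt0.
    rewrite /G ler_pdivlMr ?cnt_gt0 ?c_blk_ge0 //.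
    by case: (leP (cnt w c_blk n _)) => [cn|_]; rewrite ?mul1r ?mul0r // exprn_ge0 // ltW.
  have -> : C * u ^+ n = beta ^+ n * ((b%:R ^+ n)^-1 * (C * (gamma ^+ n)^-1)).
    by rewrite /u expr_div_n exprMn invfM; ring.
  rewrite avgM ler_wpM2l ?exprn_ge0 ?(ltW beta0) //.
  rewrite /avg ler_wpM2l ?invr_ge0 ?exprn_ge0 ?(ltW bb0) //.
  exact/sum_inv_cnt/c_blk_ge2.
have : 1 <= bad + \sum_(L <= n < M.+1) C * u ^+ n.
  rewrite -{1}(avg_cst (base_gt0 w) (q + M) 1 0).
  apply: (@le_trans _ _ (bad + avg b (q + M)
     (fun y => \sum_(0 <= n < M.+1 - L) G (n + L)%N (y / b%:R ^+ q)) 0)).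
    rewrite /bad -avgD; apply: ler_avg => [|v _]; first exact: base_gt0.
    case: goodP => [[n /andP[Ln nM] cn]|_] /=; last first.
      by rewrite lerDl sumr_ge0.
    rewrite add0r.
    have nL : (n - L < M.+1 - L)%N by lia.
    rewrite big_mkord (bigD1 (Ordinal nL)) //= subnK //.
    by rewrite /G cn lerDl sumr_ge0.
  rewrite lerD2l avg_sum -{3}(add0n L) big_addn.
  rewrite [leLHS]big_nat [leRHS]big_nat; apply: ler_sum => n /andP[_ nM].
  rewrite avg_scale ?base_gt0 // -[leRHS](avg_cst (base_gt0 w) q _ 0).
  apply: ler_avg => [|v _]; first exact: base_gt0.
  by apply: Gavg; lia.
rewrite -mulr_sumr; have := geometric_partial_sum L M.+1 u01.
set T := \sum_(L <= n < M.+1) _ => T1.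
have u1 : 0 < 1 - u by case/andP: u01 => _; lra.
have : C * T <= 4^-1.
  have : (1 - u) * (C * T) <= (1 - u) * 4^-1.
    rewrite mulrCA; apply: le_trans (ler_wpM2l (ltW C0) (le_trans T1 (ltW uL))) _.
    by rewrite le_eqVlt; apply/orP/or_introl/eqP; field; lra.
  by rewrite ler_pM2l.
lra.
Qed.

End good_scales.

Section upper_count.
Variables (R : realType) (w : skew_data R).
Local Notation b := (base w).
Local Notation c_out := (c_out w).
Local Notation c_blk := (c_blk w).
Implicit Types (x y beta : R) (n k L M q : nat).

(** Fill [0, N) greedily: a good block where one starts and fits, a single digit elsewhere. Single
    digits have multiplicity up to b instead of beta, but are few by [misses_rare]. Markov's
    inequality for [cnt] times the weight [wt] concludes. *)
Lemma count_rarely_large beta B : 0 < beta -> beta < B -> beta <= b%:R ->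
  valid w beta -> exists C th : R, [/\ 0 <= C, 0 < th, th < 1 &
  forall N x, 0 <= x <= 1 ->
    avg b N (fun y => (B ^+ N < cnt w c_out N y)%R%:R) x <= C * th ^+ N].
Proof.
move=> beta0 betaB betab vb; have B0 : 0 < B by exact: lt_trans betaB.
have b0 := base_gt0 w.
have bR : 0 < (b%:R : R) by rewrite ltr0n.
(* The five factors rho are spent as two on the coefficients [cf], two on the misses and one on the
   exponential decay of the probability. *)
pose rho := 1 - (1 - beta / B) / 5.
have bB : 0 < beta / B < 1 by rewrite divr_gt0 //= ltr_pdivrMr // mul1r.
have rho01 : 0 < rho < 1 by rewrite /rho; lra.
have [r0 r1] := andP rho01.
have rho5 : beta <= B * rho ^+ 5.
  rewrite mulrC -ler_pdivrMr //; apply: le_trans (bernoulli_ge _ _); lra.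
(* The price of a miss: multiplicity b where beta is budgeted. *)
pose Q := b%:R / beta.
have Q0 : 0 < Q by rewrite divr_gt0.
have Q1 : 1 <= Q by rewrite ler_pdivlMr // mul1r.
have [p pQ] : exists p, rho ^+ p < Q^-1.
  by apply: expr_lt_eps; rewrite ?invr_gt0 // (ltW r0).
have [L LQ] : exists L, rho ^+ L < (1 - rho) ^+ 2.
  by apply: expr_lt_eps; rewrite ?exprn_gt0 ?(ltW r0) //; lra.
have [|M [q [LM bad_rare]]] := vb L.+1 (4^-1 ^+ p); first by rewrite exprn_gt0.
pose f y := ~~ good w c_blk beta L.+1 M y.
have M0 : (0 < M)%N by exact: leq_trans LM.
have f_per y : f (y + (b ^ M)%:R) = f y by rewrite /f good_periodic.
have small : 4 ^+ p * (4^-1 ^+ p) <= 1 :> R.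
  by rewrite -exprMn divff ?expr1n.
have [C [th [C0 th0 th1 rareP]]] := misses_rare b0 f_per M0 bad_rare small.
pose e := misses b f M.
pose C1 := (p * (q + M).*2)%N.
(* The bound cf n >= rho^(2n) is used for n = 1 and n > L. The atom at 1 serves single digits; for
   long blocks L was chosen with rho^L < (1 - rho)^2. *)
pose cf n : R := rho * (n == 1%N)%:R + (1 - rho) ^+ 2 * rho ^+ n.
pose wt N y : R := (rho ^+ 2 / beta) ^+ N / Q ^+ e N y.
have base1 : 0 < rho ^+ 2 / beta by rewrite divr_gt0 ?exprn_gt0.
have wt0 N y : 0 < wt N y by rewrite divr_gt0 ?exprn_gt0.
have wtge0 N y := ltW (wt0 N y).
have cf0 n : 0 <= cf n by rewrite addr_ge0 ?mulr_ge0 ?exprn_ge0 // ?(ltW r0) //; lra.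
have cf1 N : \sum_(1 <= n < N.+1) cf n <= 1.
  rewrite big_split /=.
  have : \sum_(1 <= n < N.+1) rho * (n == 1%N)%:R <= rho.
    case: N => [|N]; first by rewrite big_geq // ltW.
    rewrite big_ltn // eqxx mulr1 big_nat big1 ?addr0 // => n /andP[n2 _].
    by rewrite gtn_eqF // mulr0.
  have : \sum_(1 <= n < N.+1) (1 - rho) ^+ 2 * rho ^+ n <= 1 - rho.
    rewrite -mulr_sumr expr2 -mulrA ler_piMr //; first by lra.
    apply: le_trans (geometric_partial_sum _ _ _) _; first by rewrite (ltW r0).
    by rewrite expr1 ltW.
  lra.
have wt_rec N y : (0 < N)%N -> wt N y <= \sum_(1 <= n < N.+1)
    cf n / cnt w c_blk n y * wt (N - n)%N (y / b%:R ^+ n).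
  move=> N0; suff [n /andP[n0 nN] h] : exists2 n, (0 < n <= N)%N &
      wt N y <= cf n / cnt w c_blk n y * wt (N - n)%N (y / b%:R ^+ n).
    apply: le_trans h _; rewrite (@big_cat_nat _ _ _ n) //=; last exact: leqW.
    rewrite (@big_ltn _ _ _ n) // addrCA lerDl addr_ge0 // sumr_ge0 // => i _.
      by rewrite mulr_ge0 // divr_ge0 // cnt_ge0.
    by rewrite mulr_ge0 // divr_ge0 // cnt_ge0.
  have [fy|] := boolP (f y || (N < M)%N).
    exists 1%N => //; rewrite /wt /e misses_recl // expr1 subn1.
    rewrite -(prednK N0) [X in _ ^+ X]/= exprS [Q ^+ _.+1]exprS invfM.
    rewrite mulrACA; apply: ler_wpM2r; first by rewrite divr_ge0 ?exprn_ge0 // ltW.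
    have -> : rho ^+ 2 / beta / Q = rho ^+ 2 / b%:R.
      by rewrite /Q; field; rewrite !gt_eqF.
    rewrite ler_pM ?invr_ge0 ?exprn_ge0 ?(ltW r0) ?(ltW bR) //.
      apply: (@le_trans _ _ rho).
        by rewrite expr2 ler_piMr // ltW.
      rewrite /cf eqxx mulr1 lerDl mulr_ge0 ?exprn_ge0 // ?(ltW r0) //; lra.
    rewrite lef_pV2 ?posrE ?cnt_gt0 ?c_blk_ge0 //.
    by rewrite -[leRHS]expr1; exact: cnt_le.
  rewrite negb_or -leqNgt negbK => /andP[/goodP[n /andP[Ln nM] cn] MN].
  have nN : (n <= N)%N by exact: leq_trans MN.
  have n0 : (0 < n)%N by exact: leq_trans Ln.
  exists n; first by rewrite n0.
  have e_le : (e (N - n) (y / b%:R ^+ n) <= e N y)%N by exact: misses_shift.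
  rewrite /wt -{1}(subnKC nN) exprD -mulrA.
  have -> : (rho ^+ 2 / beta) ^+ n = rho ^+ 2 ^+ n * (beta ^+ n)^-1.
    by rewrite expr_div_n.
  apply: ler_pM.
  - by rewrite mulr_ge0 ?invr_ge0 ?exprn_ge0 // ltW.
  - by rewrite mulr_ge0 ?invr_ge0 ?exprn_ge0 // ltW.
  - apply: ler_pM.
    + by rewrite !exprn_ge0 // ltW.
    + by rewrite invr_ge0 exprn_ge0 // ltW.
    + rewrite /cf -exprM mulnC exprM expr2 exprSr expr1.
      apply: (@le_trans _ _ ((1 - rho) ^+ 2 * rho ^+ n)); last first.
        by rewrite lerDr mulr_ge0 // ltW.
      rewrite -expr2 ler_wpM2r ?exprn_ge0 ?(ltW r0) // (le_trans _ (ltW LQ)) //.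
      by rewrite ler_wiXn2l ?(ltW r0) ?(ltW r1) // ltnW.
    + by rewrite lef_pV2 ?posrE ?exprn_gt0 ?cnt_gt0 ?c_blk_ge0.
  - rewrite ler_wpM2l ?exprn_ge0 ?(ltW base1) // lef_pV2 ?posrE ?exprn_gt0 //.
    by rewrite ler_weXn2l.
have wt_0 y : wt 0%N y <= 1 by rewrite /wt /e /misses big_nil !expr0 divr1.
have key N x := cnt_weight_le1 (c_out_ge0 w) cf0 cf1 wtge0 wt_0 wt_rec N x.
pose th' := Num.max th rho.
have th'0 : 0 < th' by rewrite lt_max th0.
have th'1 : th' < 1 by rewrite gt_max th1.
exists (C + 1 + (th' ^+ C1)^-1), th'; split => // [|N x x01].
  by rewrite !addr_ge0 // invr_ge0 exprn_ge0 // ltW.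
have thN : th ^+ N <= th' ^+ N by rewrite lerXn2r ?nnegrE ?(ltW th0) ?(ltW th'0) // le_max lexx.
have rhoN : rho ^+ N <= th' ^+ N.
  by rewrite lerXn2r ?nnegrE ?(ltW r0) ?(ltW th'0) // le_max lexx orbT.
have th'N := exprn_gt0 N th'0.
(* For N < C1 the trivial bound 1 is absorbed by the last summand of the constant. *)
have [NC|CN] := ltnP N C1.
  apply: (@le_trans _ _ 1).
    rewrite -[leRHS](avg_cst b0 N 1 x); apply: ler_avg => // v _.
    by rewrite lern1 leq_b1.
  apply: (@le_trans _ _ ((th' ^+ C1)^-1 * th' ^+ N)).
    rewrite ler_pdivlMl ?exprn_gt0 // mulr1 ler_wiXn2l ?(ltW th'0) ?(ltW th'1) //.
    exact: ltnW.
  by rewrite ler_pM2r // lerDr addr_ge0.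
apply: (@le_trans _ _ (C * th ^+ N + rho ^+ N)); last first.
  have Cth := ler_wpM2l C0 thN.
  have : 0 < (th' ^+ C1)^-1 * th' ^+ N by rewrite mulr_gt0 ?invr_gt0 ?exprn_gt0.
  rewrite !mulrDl mul1r; lra.
apply: (@le_trans _ _ (avg b N (fun y => (N + C1 < p * e N y)%N%:R +
    rho ^+ N * (cnt w c_out N y * wt N y)) x)); last first.
  rewrite avgD avgM lerD // ?rareP // -[leRHS]mulr1 ler_wpM2l ?exprn_ge0 ?(ltW r0) //.
apply: ler_avg => // v _; set y := x + v%:R.
have cw0 : 0 <= cnt w c_out N y * wt N y by rewrite mulr_ge0 // cnt_ge0.
have [Bcnt|_] := ltP; last first.
  by rewrite addr_ge0 // mulr_ge0 // exprn_ge0 // ltW.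
have [_|few] := ltnP; first by rewrite lerDl mulr_ge0 // exprn_ge0 // ltW.
rewrite add0r.
(* Here p * e <= N + C1 <= 2N, and p was chosen with Q < rho^-p. *)
have Qe : rho ^+ N * rho ^+ N <= (Q ^+ e N y)^-1.
  apply: (@le_trans _ _ ((rho ^+ p) ^+ e N y)); last first.
    by rewrite -exprVn lerXn2r ?nnegrE ?invr_ge0 ?exprn_ge0 ?(ltW r0) ?(ltW Q0) // ltW.
  rewrite -exprM -exprD ler_wiXn2l ?(ltW r0) ?(ltW r1) //.
  by apply: leq_trans few _; rewrite leq_add2l.
have B1 : 1 <= (B * rho ^+ 5 / beta) ^+ N.
  by rewrite exprn_ege1 // ler_pdivlMr // mul1r.
apply: le_trans B1 _.
have -> : (B * rho ^+ 5 / beta) ^+ N =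
    rho ^+ N * (B ^+ N * ((rho ^+ 2 / beta) ^+ N * (rho ^+ N * rho ^+ N))).
  by rewrite -!exprMn; congr (_ ^+ _); ring.
rewrite ler_wpM2l ?exprn_ge0 ?(ltW r0) // ler_pM ?exprn_ge0 ?(ltW B0) ?(ltW Bcnt) //.
  by rewrite mulr_ge0 ?exprn_ge0 ?(ltW base1) // mulr_ge0 ?exprn_ge0 ?(ltW r0).
by rewrite ler_wpM2l ?exprn_ge0 ?(ltW base1).
Qed.

End upper_count.

(** * Lebesgue measure, inverse branches and integrated averages *)

Section lebesgue_branches.
Context {R : realType}.
Implicit Types (p v : nat).
Local Notation mu := (@lebesgue_measure R).

Let aff p v (x : R) : R := (x + v%:R) / p%:R.

Let measurable_aff p v : measurable_fun setT (aff p v : measurableTypeR R -> measurableTypeR R).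
Proof. by apply: measurable_funM => //; apply: measurable_funD. Qed.

(** The scaled pushforward gives half-open intervals their length, hence is Lebesgue measure by
    uniqueness. *)
Lemma lebesgue_measure_branch p v (A : set R) : (0 < p)%N -> measurable A ->
  mu (aff p v @^-1` A) = (p%:R%:E * mu A)%E.
Proof.
move=> p0 mA; have pR : 0 < p%:R :> R by rewrite ltr0n.
have k0 : (0 <= (p%:R^-1 : R)) by rewrite invr_ge0 ltW.
have -> : mu A = pushforward (mscale (NngNum k0) mu) (aff p v : measurableTypeR R -> measurableTypeR R) A.
  apply: (lebesgue_measure_unique (mu := [the {measure set _ -> \bar R} of pushforward _ _])) => //=.
  move=> _ [[a c]] _ <-.
  rewrite /mscale /pushforward /=.
  have -> : aff p v @^-1` `]a, c]%classic = `]a * p%:R - v%:R, c * p%:R - v%:R]%classic.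
    apply/seteqP; split => x /=; rewrite !in_itv /= /aff ltr_pdivlMr // ler_pdivrMr //.
      by rewrite ltrBlDr lerBrDr.
    by rewrite ltrBlDr lerBrDr.
  rewrite !lebesgue_measure_itv /= !lte_fin ltrD2r ltr_pM2r //.
  case: ifPn => _; last by rewrite mule0.
  by rewrite -!EFinB -EFinM; congr (_%:E); field; rewrite gt_eqF.
by rewrite /mscale /= muleA -EFinM divff ?gt_eqF // mul1e.
Qed.

Let integral_branch p v (g : R -> R) : (0 < p)%N -> measurable_fun setT g ->
  (forall x, 0 <= g x) ->
  (\int[mu]_(x in `[0%R, 1%R[) (g (aff p v x))%:E =
   p%:R%:E * \int[mu]_(x in `[(v%:R / p%:R)%R, (v.+1%:R / p%:R)%R[) (g x)%:E)%E.
Proof.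
move=> p0 mg g0; have pR : 0 < p%:R :> R by rewrite ltr0n.
have mg' D : measurable_fun D (EFin \o g).
  exact/measurable_EFinP/measurable_funTS.
have -> : `[0, 1[%classic = aff p v @^-1` `[v%:R / p%:R, v.+1%:R / p%:R[%classic.
  apply/seteqP; split => x /=; rewrite !in_itv /= /aff ler_pM2r ?invr_gt0 //
    ltr_pM2r ?invr_gt0 // -natr1 lerDr addrC ltrD2l //.
rewrite -(@ge0_integral_pushforward _ _ _ _ _ _ (measurable_aff p v) mu _ (EFin \o g)) //; last by move=> y _; rewrite lee_fin.
rewrite (eq_measure_integral (mscale (NngNum (ler0n R p)) mu)).
  rewrite ge0_integral_mscale //; first exact: mg'.
  by move=> x _; rewrite lee_fin.
  by move=> A mA _; exact: lebesgue_measure_branch.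
exact: mg'.
Qed.

(** Invariance of Lebesgue measure under x |-> p x mod 1: the images of the inverse branches tile
    [0, 1). *)
Lemma integral_branches p (g : R -> R) : (0 < p)%N -> measurable_fun setT g ->
  (forall x, 0 <= g x) ->
  (\int[mu]_(x in `[0%R, 1%R[) (p%:R^-1 * \sum_(0 <= v < p) g ((x + v%:R) / p%:R))%:E =
   \int[mu]_(x in `[0%R, 1%R[) (g x)%:E)%E.
Proof.
move=> p0 mg g0; have pR : 0 < p%:R :> R by rewrite ltr0n.
have mg' D : measurable_fun D (EFin \o g).
  exact/measurable_EFinP/measurable_funTS.
have mga v D : measurable_fun D (fun x => (g (aff p v x))%:E).
  apply/measurable_EFinP/measurable_funTS.
  by apply: measurableT_comp => //; exact: measurable_aff.
transitivity (p%:R^-1%:E * \sum_(0 <= v < p) \int[mu]_(x in `[0%R, 1%R[) (g (aff p v x))%:E)%E.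
  rewrite -ge0_integral_sum //; last by move=> v x _; rewrite lee_fin.
  rewrite -ge0_integralZl_EFin //.
  - by apply: eq_integral => x _; rewrite sumEFin.
  - by move=> x _; rewrite sume_ge0 // => v _; rewrite lee_fin.
  - by apply: emeasurable_sum => v; exact: mga.
  by move=> v; exact: mga.
rewrite (eq_bigr _ (fun v _ => integral_branch v p0 mg g0)) -ge0_sume_distrr; last first.
  by move=> v _; apply: integral_ge0 => x _; rewrite lee_fin.
rewrite muleA -EFinM mulVf ?gt_eqF // mul1e.
have split n : (\sum_(0 <= v < n) \int[mu]_(x in `[(v%:R / p%:R)%R, (v.+1%:R / p%:R)%R[) (g x)%:E =
    \int[mu]_(x in `[0%R, (n%:R / p%:R)%R[) (g x)%:E)%E.
  elim: n => [|n IH].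
    by rewrite big_nil mul0r set_itvco0 integral_set0.
  rewrite big_nat_recr //= IH -ge0_integral_setU //.
  - congr integral; rewrite -itv_bndbnd_setU ?bnd_simp //.
    by rewrite ler_pM2r ?invr_gt0 // ler_nat.
  - exact: mg'.
  - by move=> x _; rewrite lee_fin.
  - apply/disj_setPS => x /= []; rewrite !in_itv /= => /andP[_ xn] /andP[nx _].
    by move: (lt_le_trans xn nx); rewrite ltxx.
by rewrite split divff ?gt_eqF.
Qed.

End lebesgue_branches.

Section measurability.
Variables (R : realType) (w : skew_data R).
Implicit Types (c beta : R) (n L M : nat).

Lemma measurable_forcing : measurable_fun setT (forcing w).
Proof.
apply: continuous_measurable_fun => x; apply/cvgrPdist_lt => e e0.
have l0 : 0 < forcing_lip w + 1 by have := forcing_lip_ge0 w; lra.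
near=> y; apply: le_lt_trans (forcing_lipP w x y) _.
apply: (@le_lt_trans _ _ ((forcing_lip w + 1) * `|x - y|)).
  by rewrite ler_wpM2r // lerDl.
rewrite mulrC -ltr_pdivlMr //; near: y.
by apply: (@cvgr_dist_lt _ R) => //; rewrite divr_gt0.
Unshelve. all: by end_near. Qed.

Lemma measurable_partS n : measurable_fun setT (partS w n).
Proof.
apply: measurable_sum => k; apply: measurable_funM => //.
apply: (measurableT_comp measurable_forcing).
exact: measurable_funM.
Qed.

Lemma measurable_natr d (T : measurableType d) (f : T -> bool) :
  measurable_fun setT f -> measurable_fun setT (fun x => (f x)%:R : R).
Proof.
move=> mf; rewrite (_ : (fun _ => _) = fun x => if f x then 1 else 0 : R).
  by apply: measurable_fun_ifT.
by apply/funext => x; case: (f x).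
Qed.

Lemma measurable_cnt c n : measurable_fun setT (cnt w c n).
Proof.
apply: measurable_sum => v; apply: measurable_natr; apply: measurable_fun_ler => //.
apply: measurableT_comp => //; apply: measurable_funB; last exact: measurable_partS.
apply: (measurableT_comp (measurable_partS n)); exact: measurable_funD.
Qed.

Lemma measurable_good c beta L M : measurable_fun setT (good w c beta L M).
Proof.
rewrite /good; elim: (index_iota _ _) => [|n s IH] //=.
apply: measurable_or => //; apply: measurable_fun_ler => //; exact: measurable_cnt.
Qed.

Lemma measurable_avg b m (f : R -> R) : measurable_fun setT f ->
  measurable_fun setT (avg b m f).
Proof.
move=> mf; apply: measurable_funM => //; apply: measurable_sum => v.
by apply: (measurableT_comp mf); exact: measurable_funD.
Qed.

End measurability.

Section mean.
Variables (R : realType) (b : nat).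
Hypothesis b_gt0 : (0 < b)%N.
Local Notation mu := (@lebesgue_measure R).
Implicit Types (f g : R -> R) (m n k : nat).

(* The integral of [f] over [0, b^m), divided by b^m. *)
Definition mean m f : \bar R := (\int[mu]_(x in `[0%R, 1%R[) (avg b m f x)%:E)%E.

Let measurable_avg' m f : measurable_fun setT f ->
  measurable_fun (`[0%R, 1%R[%classic : set R) (fun x => (avg b m f x)%:E).
Proof. by move=> mf; apply/measurable_EFinP/measurable_funTS; exact: measurable_avg. Qed.

Lemma mean_ge0 m f : (forall y, 0 <= f y) -> (0 <= mean m f)%E.
Proof. by move=> f0; apply: integral_ge0 => x _; rewrite lee_fin avg_ge0. Qed.

Lemma le_mean m f g : measurable_fun setT f -> measurable_fun setT g ->
  (forall y, 0 <= f y) -> (forall y, f y <= g y) -> (mean m f <= mean m g)%E.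
Proof.
move=> mf mg f0 fg; apply: ge0_le_integral => //.
- by move=> x _; rewrite lee_fin avg_ge0.
- exact: measurable_avg'.
- exact: measurable_avg'.
- by move=> x _; rewrite lee_fin ler_avg.
Qed.

Lemma mean_le_cst m f (c : R) : measurable_fun setT f -> (forall y, 0 <= f y) ->
  (forall x, 0 <= x <= 1 -> avg b m f x <= c) -> (mean m f <= c%:E)%E.
Proof.
move=> mf f0 fc; apply: (@le_trans _ _ (\int[mu]_(x in `[0%R, 1%R[) c%:E)%E).
  apply: ge0_le_integral => //.
  - by move=> x _; rewrite lee_fin avg_ge0.
  - exact: measurable_avg'.
  - move=> x /=; rewrite in_itv /= => /andP[x0 x1].
    by rewrite lee_fin fc // x0 ltW.
by rewrite integral_cst //= lebesgue_measure_itv /= lte_fin ltr01 oppr0 adde0 mule1.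
Qed.

Lemma mean_widen m n f : nat_periodic (b ^ m) f -> mean (m + n) f = mean m f.
Proof. by move=> fp; apply: eq_integral => x _; rewrite avg_widen. Qed.

(** Stationarity: once x is integrated out, dropping the first k digits does not change the law. *)
Lemma mean_scale k m f : measurable_fun setT f -> (forall y, 0 <= f y) ->
  mean (k + m) (fun y => f (y / b%:R ^+ k)) = mean m f.
Proof.
move=> mf f0; rewrite /mean -(@integral_branches _ (b ^ k) (avg b m f)).
- by apply: eq_integral => x _; rewrite avg_scale // /avg natrX.
- by rewrite expn_gt0 b_gt0.
- exact: measurable_avg.
- by move=> x; exact: avg_ge0.
Qed.

Lemma meanD m f g : measurable_fun setT f -> measurable_fun setT g ->
  (forall y, 0 <= f y) -> (forall y, 0 <= g y) ->
  mean m (fun y => f y + g y) = (mean m f + mean m g)%E.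
Proof.
move=> mf mg f0 g0; rewrite /mean -ge0_integralD //.
- by apply: eq_integral => x _; rewrite avgD EFinD.
- by move=> x _; rewrite lee_fin avg_ge0.
- exact: measurable_avg'.
- by move=> x _; rewrite lee_fin avg_ge0.
- exact: measurable_avg'.
Qed.

Lemma mean_sum m (I : nat) (F : nat -> R -> R) :
  (forall i, measurable_fun setT (F i)) -> (forall i y, 0 <= F i y) ->
  mean m (fun y => \sum_(0 <= i < I) F i y) = (\sum_(0 <= i < I) mean m (F i))%E.
Proof.
move=> mF F0; rewrite /mean -ge0_integral_sum //.
- by apply: eq_integral => x _; rewrite avg_sum sumEFin.
- by move=> i; exact: measurable_avg'.
- by move=> i x _; rewrite lee_fin avg_ge0.
Qed.

End mean.

(** * Zero-one law for small multiplicities *)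

Section lower_count.
Variables (R : realType) (w : skew_data R).
Local Notation b := (base w).
Local Notation gamma := (rate w).
Local Notation c_blk := (c_blk w).
Local Notation c_low := (c_blk + 1).
Implicit Types (x y beta : R) (n k L M q : nat).

Let b0 := base_gt0 w.

Lemma good_shift c beta beta' L M1 M' k y : 0 < beta' -> (L + k <= M1)%N ->
  (forall n, (M1 <= n)%N -> beta' ^+ n <= beta ^+ (n - k)) ->
  good w c beta' M1 M' y -> good w c beta L M' (y / b%:R ^+ k).
Proof.
move=> b'0 LM bb /goodP[n /andP[M1n nM'] cn]; apply/goodP; exists (n - k)%N.
  by apply/andP; split; lia.
apply: le_trans (bb n M1n); apply: le_trans cn.
by rewrite -[in leRHS](@subnKC k n) ?cnt_scale //; lia.
Qed.

(* Zero-one law: if the block starting at [y] is good with probability bounded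
   away from one for all [M], then so are independently the blocks met along the
   orbit of [y], while a single large scale with small multiplicity makes all of
   them good. *)
Lemma count_rarely_small beta beta' (eps : R) : 0 < beta' -> beta' < beta ->
  ~ valid w beta -> 0 < eps ->
  exists M1, forall M',
    (mean b M' (fun y => (good w c_low beta' M1 M' y)%:R) <= eps%:E)%E.
Proof.
move=> b'0 b'b nvalid eps0.
have [L [del [del0 bad_freq]]] : exists L (del : R), 0 < del /\
    forall M q, (L <= M)%N -> exists2 x : R, 0 <= x <= 1 &
      del < avg b (q + M) (fun y => (~~ good w c_blk beta L M (y / b%:R ^+ q))%:R) x.
  apply: contrapT => h; apply: nvalid => L del del0; apply: contrapT => h'.
  apply: h; exists L, del; split => // M q LM; apply: contrapT => h''.
  apply: h'; exists M, q; split => // x x01; rewrite leNgt; apply/negP => h3.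
  by apply: h''; exists x.
pose G c M y : R := (good w c beta L M y)%:R.
have mG c M : measurable_fun setT (G c M) by apply: measurable_natr; exact: measurable_good.
have G0 c M y : 0 <= G c M y by [].
have G_per c M : nat_periodic (b ^ M) (G c M) by move=> y; rewrite /G good_periodic.
have mean_fin m (f : R -> R) : measurable_fun setT f -> (forall y : R, 0 <= f y <= 1) ->
    exists2 r : R, mean b m f = r%:E & 0 <= r <= 1.
  move=> mf f01; have f0 y : 0 <= f y by case/andP: (f01 y).
  have := mean_ge0 b0 m f0.
  have : (mean b m f <= 1%:E)%E.
    apply: mean_le_cst => // x _; rewrite -(avg_cst b0 m 1 x).
    by apply: ler_avg => // v _; case/andP: (f01 (x + v%:R)).
  by case: (mean b m f) => // r; rewrite !lee_fin => r1 r0; exists r; rewrite ?r0.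
have ind01 (P : bool) : 0 <= (P%:R : R) <= 1 by case: P; rewrite ?lexx ?ler01.
have G01 c M y : 0 <= G c M y <= 1 by exact: ind01.
pose g M := fine (mean b M (G c_low M)).
have gE M : (mean b M (G c_low M) = (g M)%:E)%E.
  by rewrite /g; have [r ->] := mean_fin M _ (mG c_low M) (G01 c_low M).
have g1 M : g M <= 1.
  by rewrite /g; have [r -> /andP[]] := mean_fin M _ (mG c_low M) (G01 c_low M).
pose B := 1 - del.
have del1 : del < 1.
  have [x _ dx] := bad_freq L 0%N (leqnn _); apply: lt_le_trans dx _.
  rewrite -[leRHS](avg_cst b0 (0 + L) 1 x); apply: ler_avg => // v _.
  by case/andP: (ind01 (~~ good w c_blk beta L L ((x + v%:R) / b%:R ^+ 0))).
have [I BI] : exists I, B ^+ I < eps / 2.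
  by apply: expr_lt_eps; rewrite ?divr_gt0 // /B; lra.
pose eps1 := eps / 2 / I.+1%:R.
have eps10 : 0 < eps1 by rewrite /eps1 !divr_gt0.
(* Take M0 with [g M0] within eps1 of the supremum of [g]: blocks that become good only beyond M0
   are then rare. *)
have [M0 LM0 gM0] : exists2 M0, (L <= M0)%N & forall M', (M0 <= M')%N -> g M' <= g M0 + eps1.
  pose S := [set g M | M in [set M | (L <= M)%N]].
  have S_sup : has_sup S.
    split; first by exists (g L), L => //=.
    by exists 1 => _ [M _ <-].
  have [_ [M0 /= LM0 <-] sM0] := sup_adherent eps10 S_sup.
  exists M0 => // M' MM'; rewrite -lerBlDr.
  apply: le_trans (ltW sM0); rewrite lerD2r; apply: ub_le_sup; first by case: S_sup.
  by exists M' => //=; exact: leq_trans MM'.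
(* After q common digits, any two starting points in [0, 1] are within the tolerance of [good_close]
   at scale M0. *)
have [q qM0] : exists q, 2 * forcing_lip w * (b%:R ^+ q)^-1 <= gamma ^+ M0.
  have l0 := forcing_lip_ge0 w.
  have [||q] := @expr_lt_eps R (b%:R^-1) (gamma ^+ M0 / (2 * forcing_lip w + 1)).
  - by rewrite invr_ge0 ler0n /= invf_lt1 ?ltr0n // ltr1n base_ge2.
  - by rewrite divr_gt0 ?rateX_gt0 //; lra.
  rewrite exprVn ltr_pdivlMr; last by lra.
  move=> h; exists q; apply: le_trans (ltW h); rewrite mulrC; apply: ler_wpM2l; last by lra.
  by rewrite invr_ge0 exprn_ge0.
pose l := (q + M0)%N.
pose h y : R := G c_low M0 (y / b%:R ^+ q).
(* One x' with many bad blocks controls every x: good at x with constant c_blk + 1 implies good at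
   x' with constant c_blk. *)
have h_rare x : 0 <= x <= 1 -> avg b l h x <= B.
  move=> /andP[x0 x1]; have [x' /andP[x'0 x'1] x'del] := bad_freq M0 q LM0.
  apply: (@le_trans _ _ (1 - avg b l (fun y => (~~ good w c_blk beta L M0 (y / b%:R ^+ q))%:R) x')).
    rewrite lerBrDr.
    apply: (@le_trans _ _ (avg b l (fun y => (good w c_blk beta L M0 (y / b%:R ^+ q))%:R) x' +
       avg b l (fun y => (~~ good w c_blk beta L M0 (y / b%:R ^+ q))%:R) x')).
      rewrite lerD2r ler_pM2l ?invr_gt0 ?baseX_gt0 //.
      apply: ler_sum => v _; rewrite ler_nat /h /G.
      case: (boolP (good w c_low _ _ _ _)) => // gd; rewrite (good_close _ gd) //.
      apply: le_trans qM0; rewrite ler_wpM2l ?mulr_ge0 ?forcing_lip_ge0 //.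
      rewrite -mulrBl normrM [`|_^-1|]ger0_norm ?invr_ge0 ?(ltW (baseX_gt0 w q)) //.
      rewrite ler_piMl ?invr_ge0 ?(ltW (baseX_gt0 w q)) // opprD addrACA subrr addr0.
      by rewrite ler_norml; lra.
    rewrite -avgD -[leRHS](avg_cst b0 l 1 x'); apply: ler_avg => // v _.
    by case: good; rewrite ?addr0 ?add0r.
  by rewrite /B; lra.
pose K := (I * l)%N.
(* From n0 on, the gap between beta' and beta pays for lowering the exponent from n to n - k, for
   any k <= K. *)
have [n0 n0P] : exists n0, (beta' / beta) ^+ n0 < (Num.max 1 beta ^+ K)^-1.
  have be0 : 0 < beta by exact: lt_trans b'b.
  apply: expr_lt_eps; first by rewrite divr_ge0 ?ltW //= ltr_pdivrMr // mul1r.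
  by rewrite invr_gt0 exprn_gt0 // lt_max ltr01.
pose M1 := maxn M0 (maxn n0 (L + K)).
exists M1 => M'.
have [M'M1|M1M'] := ltnP M' M1.
  rewrite (_ : (fun _ => _) = fun=> 0); last first.
    apply/funext => y; case: goodP => // -[n /andP[a1 a2] _].
    by have := leq_ltn_trans (leq_trans a1 a2) M'M1; rewrite ltnn.
  apply: mean_le_cst => // x _; by rewrite avg_cst // ltW.
have M0M' : (M0 <= M')%N by apply: leq_trans M1M'; rewrite leq_max leqnn.
have n0M1 : (n0 <= M1)%N by rewrite /M1 !leq_max leqnn orbT.
have LKM1 : (L + K <= M1)%N by rewrite /M1 !leq_max leqnn !orbT.
pose U y : R := (good w c_low beta' M1 M' y)%:R.
pose A y : R := (good w c_low beta L M' y && ~~ good w c_low beta L M0 y)%:R.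
have mU : measurable_fun setT U by apply: measurable_natr; exact: measurable_good.
have mA : measurable_fun setT A.
  apply: measurable_natr; apply: measurable_and; first exact: measurable_good.
  apply: measurable_neg; exact: measurable_good.
have A01 y : 0 <= A y <= 1 by exact: ind01.
have A_per : nat_periodic (b ^ M') A.
  by move=> y; rewrite /A good_periodic good_periodic_ge.
(* Either all I blocks are good within M0, which has mean at most B^I, or one of them is good only
   beyond M0, which has mean at most eps1 for each block. *)
have UA y : U y <= \sum_(0 <= i < I) A (y / b%:R ^+ (q + i * l)) +
    \prod_(0 <= i < I) h (y / b%:R ^+ (i * l)).
  have h0 z : 0 <= h z by [].
  rewrite /U; case: (boolP (good _ _ _ _ _ _)) => [gd|_]; last first.
    by rewrite addr_ge0 ?sumr_ge0 ?prodr_ge0.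
  have gd' i : (i < I)%N -> good w c_low beta L M' (y / b%:R ^+ (q + i * l)).
    move=> iI; have kK : (q + i * l <= K)%N.
      by apply: (@leq_trans (i.+1 * l)); rewrite ?leq_mul2r ?iI ?orbT // mulSn leq_add2r leq_addr.
    apply: good_shift gd => // [|n M1n]; first by apply: leq_trans LKM1; rewrite leq_add2l.
    set k := (q + i * l)%N in kK *.
    have be0 : 0 < beta by exact: lt_trans b'b.
    have kn : (k <= n)%N by apply: leq_trans kK _; lia.
    rewrite -(ler_pM2r (exprn_gt0 k be0)) -exprD subnK //.
    have -> : beta' = beta' / beta * beta by rewrite divfK ?gt_eqF.
    set u := beta' / beta in n0P *.
    have u01 : 0 <= u <= 1.
      by rewrite divr_ge0 ?(ltW b'0) ?(ltW be0) //= ler_pdivrMr // mul1r ltW.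
    rewrite exprMn mulrAC ler_piMl ?exprn_ge0 ?(ltW be0) //.
    set X := Num.max 1 beta in n0P *.
    have X1 : 1 <= X by rewrite le_max lexx.
    have X0 : 0 < X by exact: lt_le_trans X1.
    apply: (@le_trans _ _ (u ^+ n0 * X ^+ K)); last first.
      by rewrite -ler_pdivlMr ?exprn_gt0 // mul1r ltW.
    case/andP: u01 => u0 u1.
    apply: ler_pM; rewrite ?exprn_ge0 ?(ltW be0) //.
      by rewrite ler_wiXn2l // (leq_trans n0M1).
    apply: (@le_trans _ _ (X ^+ k)); last by rewrite ler_weXn2l.
    by rewrite lerXn2r ?nnegrE ?(ltW be0) ?(ltW X0) // le_max lexx orbT.
  have sum0 : 0 <= \sum_(0 <= i < I) A (y / b%:R ^+ (q + i * l)).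
    by rewrite sumr_ge0 // => i _; case/andP: (A01 (y / b%:R ^+ (q + i * l))).
  have [/allP allg|/allPn[i]] :=
      boolP (all (fun i => good w c_low beta L M0 (y / b%:R ^+ (q + i * l))) (index_iota 0 I)).
    rewrite [X in _ <= _ + X]big_seq [X in _ <= _ + X]big1 ?lerDr // => i iI.
    by rewrite /h /G -mulrA -invfM -exprD addnC allg.
  rewrite mem_index_iota => /andP[_ iI] ngi.
  apply: (@le_trans _ _ (\sum_(0 <= i < I) A (y / b%:R ^+ (q + i * l)))); last first.
    by rewrite lerDl prodr_ge0.
  rewrite big_mkord (bigD1 (Ordinal iI)) //= {1}/A gd' // ngi lerDl sumr_ge0 //.
have measurable_scale k f : measurable_fun setT f ->
    measurable_fun setT (fun y : R => f (y / b%:R ^+ k) : R).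
  by move=> mf; apply: (measurableT_comp mf); exact: measurable_funM.
have h_per : nat_periodic (b ^ l) h.
  exact: (nat_periodic_scale b0 q (G_per c_low M0)).
have mh : measurable_fun setT h by exact: measurable_scale.
have U0 y : 0 <= U y by [].
have A0 y : 0 <= A y by [].
have mAk i : measurable_fun setT (fun y => A (y / b%:R ^+ (q + i * l))) by exact: measurable_scale.
have mP : measurable_fun setT (fun y => \prod_(0 <= i < I) h (y / b%:R ^+ (i * l))).
  by apply: measurable_prod => i _; exact: measurable_scale.
have P0 y : 0 <= \prod_(0 <= i < I) h (y / b%:R ^+ (i * l)) by rewrite prodr_ge0.
have U_per : nat_periodic (b ^ M') U by move=> y; rewrite /U good_periodic.
rewrite -(mean_widen b0 K U_per).
apply: le_trans (le_mean b0 (M' + K) mU _ U0 UA) _.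
  by apply: measurable_funD => //; exact: measurable_sum.
rewrite meanD //; last 2 first.
- exact: measurable_sum.
- by move=> y; rewrite sumr_ge0.
rewrite mean_sum // [eps]splitr EFinD; apply: leeD; last first.
  apply: mean_le_cst => // x x01; rewrite addnC avg_widen //.
    apply: le_trans (ltW BI); apply: avg_prod_blocks => //; first by rewrite /B; lra.
  exact: nat_periodic_prod_blocks.
have meanA : (mean b M' A <= eps1%:E)%E.
  have := meanD b0 M' mA (mG c_low M0) A0 (G0 c_low M0).
  rewrite (_ : (fun y => A y + G c_low M0 y) = G c_low M'); last first.
    apply/funext => y; rewrite /A /G.
    have [gd|_] := boolP (good w c_low beta L M0 y); last by rewrite andbT addr0.
    by rewrite (good_widen M0M' gd) add0r.
  have [r -> _] := mean_fin M' _ mA A01.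
  rewrite gE -(subnKC M0M') mean_widen // gE -EFinD => -[gg].
  by rewrite lee_fin; have := gM0 _ M0M'; rewrite -{1}(subnKC M0M') gg; lra.
apply: (@le_trans _ _ (\sum_(0 <= i < I) eps1%:E)%E).
  rewrite big_nat [leRHS]big_nat; apply: lee_sum => i /andP[_ iI].
  have kK : (q + i * l <= K)%N.
    by apply: (@leq_trans (i.+1 * l)); rewrite ?leq_mul2r ?iI ?orbT // mulSn leq_add2r leq_addr.
  rewrite (_ : M' + K = (q + i * l + M') + (K - (q + i * l)))%N; last by lia.
  rewrite mean_widen //; last by move=> y; rewrite nat_periodic_scale.
  by rewrite mean_scale.
rewrite sumEFin lee_fin sumr_const_nat subn0 -[_ *+ I]mulr_natl /eps1.
rewrite mulrCA ler_piMr ?divr_ge0 ?(ltW eps0) // ler_pdivrMr // mul1r ler_nat.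
exact: leqnSn.
Qed.

End lower_count.

Section count_growth.
Variables (R : realType) (w : skew_data R).
Local Notation b := (base w).

Lemma count_growth : exists betas : R, [/\ b%:R * rate w <= betas, betas <= b%:R,
  forall B, betas < B -> exists C th : R, [/\ 0 <= C, 0 < th, th < 1 &
    forall N x, 0 <= x <= 1 ->
      avg b N (fun y => (B ^+ N < cnt w (c_out w) N y)%R%:R) x <= C * th ^+ N] &
  forall B eps : R, 0 < B -> B < betas -> 0 < eps -> exists M1, forall M',
    (mean b M' (fun y => (good w (c_blk w + 1) B M1 M' y)%:R) <= eps%:E)%E].
Proof.
have bR : 0 < (b%:R : R) by rewrite ltr0n base_gt0.
pose V := [set beta : R | 0 < beta /\ valid w beta].
have Vb : V b%:R by split => //; exact: valid_base.
have V_lb : lbound V (b%:R * rate w) by move=> beta [beta0 vb]; exact: valid_ge.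
have V_inf : has_inf V by split; [exists b%:R | exists (b%:R * rate w)].
exists (inf V); split.
- by apply: lb_le_inf => //; case: V_inf.
- by apply: ge_inf => //; case: V_inf.
- move=> B /(inf_lt (proj1 V_inf)) [beta [beta0 vb] betaB].
  (* A valid beta above b is replaced by b, which is valid by [valid_base]. *)
  have [betab|bbeta] := leP beta b%:R; first exact: count_rarely_large vb.
  by apply: (@count_rarely_large _ w b%:R) => //; [exact: lt_trans betaB|exact: valid_base].
- move=> B eps B0 Binf eps0.
  have /midf_lt[mid1 mid2] := Binf.
  apply: (@count_rarely_small _ w ((B + inf V) / 2)) => // vb.
  suff : inf V <= (B + inf V) / 2 by rewrite leNgt mid2.
  apply: ge_inf; first by case: V_inf.
  by split => //; exact: lt_trans mid1.
Qed.

End count_growth.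

(** * Almost sure growth *)

Definition digits_value (b : nat) (j : nat -> nat) n : nat :=
  (\sum_(0 <= i < n) j i * b ^ i)%N.

Lemma digits_valueS b j n : digits_value b j n.+1 = (digits_value b j n + j n * b ^ n)%N.
Proof. by rewrite /digits_value big_nat_recr. Qed.

Lemma digits_value_widen b j n k :
  exists u, digits_value b j (n + k) = (digits_value b j n + u * b ^ n)%N.
Proof.
elim: k => [|k [u IH]]; first by exists 0%N; rewrite addn0 mul0n addn0.
exists (u + j (n + k) * b ^ k)%N.
by rewrite addnS digits_valueS IH expnD mulnDl mulnA mulnAC addnA mulnAC.
Qed.

Section digit_law.
Variables (R : realType) (b : nat).
Hypothesis b_gt0 : (0 < b)%N.
Variables (d : measure_display) (Omega : measurableType d).
Variables (P : probability Omega R) (J : nat -> Omega -> nat).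
Hypothesis J_iid : iid_uniform_digits P b J.
Implicit Types (o : Omega) (n k v : nat).

Definition prefix_value n o : nat := digits_value b (J^~ o) n.

Let J_lt k o : (J k o < b)%N. Proof. by case: J_iid => + _; apply. Qed.

Lemma prefixS n o : prefix_value n.+1 o = (prefix_value n o + J n o * b ^ n)%N.
Proof. exact: digits_valueS. Qed.

Lemma prefix_lt n o : (prefix_value n o < b ^ n)%N.
Proof.
elim: n => [|n IH]; first by rewrite /prefix_value /digits_value big_nil.
rewrite prefixS expnS; apply: (@leq_trans ((J n o).+1 * b ^ n)).
  by rewrite mulSn ltn_add2r.
by rewrite leq_mul2r J_lt orbT.
Qed.

Lemma prefix_digit n k o : (k < n)%N -> (prefix_value n o %/ b ^ k %% b)%N = J k o.
Proof.
move=> kn; have [u] := digits_value_widen b (J^~ o) k.+1 (n - k.+1).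
rewrite subnKC // -/(prefix_value n o) => ->.
rewrite digits_valueS -/(prefix_value k o) expnS mulnA -addnA -mulnDl addnC divnMDl ?expn_gt0 ?b_gt0 //.
by rewrite divn_small ?prefix_lt // addn0 addnC modnMDl modn_small.
Qed.

Lemma sum_digits v n : (\sum_(0 <= k < n) (v %/ b ^ k %% b) * b ^ k = v %% b ^ n)%N.
Proof.
elim: n => [|n IH]; first by rewrite big_nil modn1.
rewrite big_nat_recr //= IH.
have e : v = (v %/ b ^ n %/ b * b ^ n.+1 + (v %% b ^ n + v %/ b ^ n %% b * b ^ n))%N.
  rewrite {1}(divn_eq v (b ^ n)) {1}(divn_eq (v %/ b ^ n) b) expnS; lia.
have lt : (v %% b ^ n + v %/ b ^ n %% b * b ^ n < b ^ n.+1)%N.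
  rewrite expnS; apply: (@leq_trans ((v %/ b ^ n %% b).+1 * b ^ n)).
    by rewrite mulSn ltn_add2r ltn_mod expn_gt0 b_gt0.
  by rewrite leq_mul2r ltn_mod b_gt0 orbT.
by rewrite [in RHS]e modnMDl (modn_small lt).
Qed.

Let prefix_eqE n v : (v < b ^ n)%N ->
  [set o | prefix_value n o = v] = [set o | forall k, (k < n)%N -> J k o = (v %/ b ^ k %% b)%N].
Proof.
move=> vn; apply/seteqP; split => o /=; first by move=> <- k /prefix_digit ->.
move=> Jv; rewrite -[RHS](modn_small vn) -sum_digits /prefix_value /digits_value.
by apply: eq_big_nat => k /andP[_ /Jv ->].
Qed.

Let measurable_cylinder n (u : nat -> nat) :
  measurable [set o | forall k, (k < n)%N -> J k o = u k].
Proof.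
elim: n => [|n IH].
  by rewrite (_ : [set _ | _] = setT) //; apply/seteqP; split.
rewrite (_ : [set _ | _] = [set o | forall k, (k < n)%N -> J k o = u k] `&`
    J n @^-1` [set u n]).
  by apply: measurableI => //; case: J_iid => _ [].
apply/seteqP; split => o /= h.
  by split => [k kn|]; [apply: h; exact: ltnW|exact: h].
by move=> k; rewrite ltnS leq_eqVlt => /predU1P[->|]; case: h => h1 h2 //; exact: h1.
Qed.

Let prefix_pt n v : (v < b ^ n)%N ->
  measurable [set o | prefix_value n o = v] /\ P [set o | prefix_value n o = v] = ((b%:R ^+ n)^-1)%:E.
Proof.
move=> vn; rewrite prefix_eqE //; split => //.
by case: J_iid => _ [_]; apply => k _; rewrite ltn_mod.
Qed.

(** The bound m allows an induction that adds the atoms of [prefix_value] one at a time. *)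
Let prefix_law_lt n (Q : nat -> bool) m : (m <= b ^ n)%N ->
  measurable [set o | (prefix_value n o < m)%N && Q (prefix_value n o)] /\
  P [set o | (prefix_value n o < m)%N && Q (prefix_value n o)] =
    ((b%:R ^+ n)^-1 * \sum_(0 <= v < m) (Q v)%:R)%:E.
Proof.
elim: m => [|m IH] mn.
  rewrite big_nil mulr0 (_ : [set _ | _] = set0) ?measure0 //.
  by apply/seteqP; split.
have [mA PA] := IH (ltnW mn); have [mB PB] := prefix_pt mn.
rewrite big_nat_recr //= mulrDr EFinD -PA.
case Qm : (Q m); last first.
  rewrite mulr0 adde0 (_ : [set _ | _] = [set o | (prefix_value n o < m)%N && Q (prefix_value n o)]) //.
  apply/seteqP; split => o /= /andP[h1 h2]; apply/andP; split => //.
    by move: h1; rewrite ltnS leq_eqVlt => /predU1P[e|//]; move: h2; rewrite e Qm.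
  exact: ltnW.
rewrite mulr1 -PB.
rewrite (_ : [set _ | _] = [set o | (prefix_value n o < m)%N && Q (prefix_value n o)] `|`
   [set o | prefix_value n o = m]).
  split; first exact: measurableU.
  by rewrite measureU //; apply/seteqP; split => // o /= [/andP[h _] e]; move: h; rewrite e ltnn.
apply/seteqP; split => o /=.
  rewrite ltnS leq_eqVlt => /andP[/predU1P[->|h1] h2]; [by right|left].
  by rewrite h1.
by case=> [/andP[h1 ->]|->]; rewrite ?Qm ltnS ?leqnn // ltnW.
Qed.

Lemma measurable_prefix n (Q : nat -> bool) : measurable [set o | Q (prefix_value n o)].
Proof.
have [+ _] := prefix_law_lt Q (leqnn (b ^ n)%N).
by rewrite (_ : [set _ | _] = [set o | Q (prefix_value n o)]) //;
  apply/seteqP; split => o /=; rewrite prefix_lt.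
Qed.

Lemma prefix_law n (A : R -> bool) x :
  P [set o | A (x + (prefix_value n o)%:R)] = (avg b n (fun y => (A y)%:R) x)%:E.
Proof.
have [_] := prefix_law_lt (fun v => A (x + v%:R)) (leqnn (b ^ n)%N).
by rewrite (_ : [set _ | _] = [set o | A (x + (prefix_value n o)%:R)]) //;
  apply/seteqP; split => o /=; rewrite prefix_lt.
Qed.

End digit_law.

Section limit_function.
Variables (R : realType) (w : skew_data R).
Local Notation b := (base w).
Local Notation gamma := (rate w).
Local Notation phi := (forcing w).
Local Notation D := (tail_bound w).
Local Notation S := (Sfun b gamma phi).
Implicit Types (x : R) (j : nat -> nat) (n m : nat).

(** The k-th term reads only the first k + 1 digits; the others add an integer to its argument,
    which phi does not see. *)
Lemma series_partS x j n :
  series (fun k => gamma ^+ k * phi ((x + \sum_(i < k.+1) (j i)%:R * b%:R ^+ i) / b%:R ^+ k.+1)) n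
  = partS w n (x + (digits_value b j n)%:R).
Proof.
apply: eq_big_nat => k /andP[_ kn]; congr (_ * _).
have [u] := digits_value_widen b j k.+1 (n - k.+1); rewrite subnKC // => ->.
set X := x + _.
rewrite natrD addrA [RHS](congr1 phi (mulrDl _ _ _)) natrM natrX mulfK ?baseX_neq0 //.
rewrite forcing_natD /X.
congr (phi ((x + _) / _)); rewrite /digits_value natr_sum big_mkord.
by apply: eq_bigr => i _; rewrite natrM natrX.
Qed.

Lemma Sfun_cvg x j : partS w n (x + (digits_value b j n)%:R) @[n --> \oo] --> S x j.
Proof.
under eq_fun do rewrite -series_partS.
apply: normed_cvg; apply: (@series_le_cvg _ _ (fun k => forcing_sup w * gamma ^+ k)).
- by move=> k /=.
- by move=> k; rewrite mulr_ge0 ?forcing_sup_ge0 ?(ltW (rateX_gt0 w k)).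
- move=> k /=; rewrite normrM gtr0_norm ?rateX_gt0 // mulrC.
  by rewrite ler_wpM2r ?(ltW (rateX_gt0 w k)) // forcing_supP.
apply: is_cvg_geometric_series.
by rewrite gtr0_norm ?rate_gt0 // rate_lt1.
Qed.

Lemma Sfun_tail x j n : `|S x j - partS w n (x + (digits_value b j n)%:R)| <= D * gamma ^+ n.
Proof.
apply/ler_addgt0Pr => e e0.
have /cvgrPdist_lt/(_ _ e0)[N _ /(_ (n + N)%N (leq_addl _ _)) SN] := @Sfun_cvg x j.
set s := partS w (n + N) _ in SN; set t := partS w n _.
have -> : S x j - t = (s - t) + (S x j - s) by ring.
apply: le_trans (ler_normD _ _) _; apply: lerD; last exact: ltW.
have [u uE] := digits_value_widen b j n N.
have sE : s = t + gamma ^+ n * partS w N ((x + (digits_value b j (n + N))%:R) / b%:R ^+ n).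
  by rewrite /s partS_add /t; congr (_ + _); rewrite uE natrD addrA (periodicM _ _ (partS_periodic w n)).
rewrite sE addrAC subrr add0r normrM gtr0_norm ?rateX_gt0 // mulrC.
by rewrite ler_wpM2r ?(ltW (rateX_gt0 w n)) // partS_bound.
Qed.

Lemma Sfun_lip x x' j : `|S x j - S x' j| <= forcing_lip w * `|x - x'|.
Proof.
apply/ler_addgt0Pr => e e0; have e20 : 0 < e / 2 by rewrite divr_gt0.
have /cvgrPdist_lt/(_ _ e20)[N _ SN] := @Sfun_cvg x j.
have /cvgrPdist_lt/(_ _ e20)[N' _ SN'] := @Sfun_cvg x' j.
have {}SN := SN (N + N')%N (leq_addr _ _).
have {}SN' := SN' (N + N')%N (leq_addl _ _).
set s := partS w _ _ in SN; set t := partS w _ _ in SN'.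
have -> : S x j - S x' j = (s - t) + ((S x j - s) - (S x' j - t)) by ring.
apply: le_trans (ler_normD _ _) _; apply: lerD.
  apply: le_trans (partS_lip _ _ _ _) _; rewrite le_eqVlt; apply/orP; left.
  by rewrite opprD addrACA subrr addr0.
by apply: le_trans (ler_normB _ _) _; lra.
Qed.

End limit_function.

Section borel_cantelli.
Context d (T : measurableType d) (R : realType).
Variable mu : {measure set T -> \bar R}.

Lemma ae_eventually (E : nat -> set T) : (forall n, measurable (E n)) ->
  mu (lim_sup_set E) = 0 ->
  {ae mu, forall t, exists N, forall n, (N <= n)%N -> ~ E n t}.
Proof.
move=> mE E0; exists (lim_sup_set E); split => //.
  by apply: bigcapT_measurable => n; exact: bigcup_measurable.
move=> t /= ev N _; apply: contrapT => h; apply: ev; exists N => n Nn En.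
by apply: h; exists n.
Qed.

Lemma ae_eventually_geometric (E : nat -> set T) (C th : R) :
  (forall n, measurable (E n)) -> 0 <= C -> 0 < th -> th < 1 ->
  (forall n, (mu (E n) <= (C * th ^+ n)%:E)%E) ->
  {ae mu, forall t, exists N, forall n, (N <= n)%N -> ~ E n t}.
Proof.
move=> mE C0 th0 th1 Eth; apply: ae_eventually => //; apply: lim_sup_set_cvg0 => //.
apply: (@le_lt_trans _ _ (C * (1 - th)^-1)%:E); last exact: ltry.
apply: lime_le; first exact: is_cvg_nneseries.
apply: nearW => n; apply: (@le_trans _ _ (\sum_(0 <= k < n) (C * th ^+ k)%:E)%E).
  by apply: lee_sum => k _; exact: Eth.
rewrite sumEFin lee_fin.
by apply: (geometric_le_lim n C0 th0); rewrite gtr0_norm.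
Qed.

End borel_cantelli.

Section almost_sure_counts.
Variables (R : realType) (w : skew_data R).
Local Notation b := (base w).
Local Notation mu := (@lebesgue_measure R).
Variables (d : measure_display) (Omega : measurableType d).
Variables (P : probability Omega R) (J : nat -> Omega -> nat).
Hypothesis J_iid : iid_uniform_digits P b J.
Local Notation V := (prefix_value b J).
Implicit Types (x c B : R) (o : Omega) (n M L : nat).

Let b0 := base_gt0 w.

Lemma measurable_prefix_set (A : R -> bool) x n :
  measurable [set o | A (x + (V n o)%:R)].
Proof. exact: (measurable_prefix b0 J_iid n (fun v => A (x + v%:R))). Qed.

Lemma good_prefix c B L M k x o :
  good w c B L M (x + (V (M + k) o)%:R) = good w c B L M (x + (V M o)%:R).
Proof.
have [u uE] := digits_value_widen b (J^~ o) M k.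
rewrite /prefix_value uE natrD addrA.
(* [periodicM] concerns real functions, so the predicate is read off its indicator. *)
have -> : good w c B L M (x + (digits_value b (J^~ o) M)%:R + (u * b ^ M)%:R) =
  ((good w c B L M (x + (digits_value b (J^~ o) M)%:R + (u * b ^ M)%:R))%:R != 0 :> R).
  by case: good; rewrite ?oner_eq0 ?eqxx.
rewrite (@periodicM _ (b ^ M) (fun y => (good w c B L M y)%:R)).
  by case: good; rewrite ?oner_eq0 ?eqxx.
by move=> y; rewrite good_periodic.
Qed.

Lemma as_count_le c B (C th : R) x :
  0 <= C -> 0 < th -> th < 1 -> 0 <= x <= 1 ->
  (forall N, avg b N (fun y => (B ^+ N < cnt w c N y)%R%:R) x <= C * th ^+ N) ->
  {ae P, forall o, exists N, forall n, (N <= n)%N -> cnt w c n (x + (V n o)%:R) <= B ^+ n}.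
Proof.
move=> C0 th0 th1 x01 H.
pose E n := [set o | B ^+ n < cnt w c n (x + (V n o)%:R)].
have mE n : measurable (E n) by exact: (measurable_prefix_set (fun y => B ^+ n < cnt w c n y)).
have PE n : (P (E n) <= (C * th ^+ n)%:E)%E.
  by rewrite (prefix_law b0 J_iid n (fun y => B ^+ n < cnt w c n y)) lee_fin.
apply: filterS (ae_eventually_geometric mE C0 th0 th1 PE) => o [N HN].
by exists N => n Nn; rewrite leNgt; apply/negP; exact: HN.
Qed.

(** The hypothesis gives no summable bound, so Borel-Cantelli does not apply. For each x, let s_j be
    the probability of a small multiplicity at some scale beyond M1 j. By monotone convergence s_j
    has integral at most 1/(j+1), so its infimum over j vanishes almost everywhere, and this infimum
    dominates the probability of infinitely many small multiplicities. *)
Lemma as_count_gt c B :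
  (forall eps : R, 0 < eps -> exists M1, forall M',
     (mean b M' (fun y => (good w c B M1 M' y)%:R) <= eps%:E)%E) ->
  {ae mu, forall x, (`[0%R, 1%R[%classic : set R) x ->
    {ae P, forall o, exists N, forall n, (N <= n)%N ->
       B ^+ n < cnt w c n (x + (V n o)%:R)}}.
Proof.
move=> H.
have /choice[M1 HM1] : forall j : nat, exists m, forall M',
    (mean b M' (fun y => (good w c B m M' y)%:R) <= (j.+1%:R^-1)%:E)%E.
  by move=> j; apply: H; rewrite invr_gt0.
pose h j M x o := good w c B (M1 j) M (x + (V M o)%:R).
pose H_ j x M := [set o | h j M x o].
pose a j M x : \bar R := (avg b M (fun y => (good w c B (M1 j) M y)%:R) x)%:E.
have mH j x M : measurable (H_ j x M).
  exact: (measurable_prefix_set (good w c B (M1 j) M)).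
have aE j M x : a j M x = P (H_ j x M).
  by rewrite /a -(prefix_law b0 J_iid M (good w c B (M1 j) M)).
have ndH j x : nondecreasing_seq (H_ j x).
  move=> M M' MM'; apply/subsetPset => o; rewrite /H_ /h /= => gd.
  by apply: (good_widen MM'); rewrite -(subnKC MM') good_prefix.
have nda j x : nondecreasing_seq (fun M => a j M x).
  move=> M M' MM'; rewrite !aE le_measure ?inE //.
  exact/subsetPset/ndH.
have ma j M : measurable_fun setT (a j M).
  apply/measurable_EFinP; apply: measurable_avg; apply: measurable_natr; exact: measurable_good.
have mTS (f : R -> \bar R) : measurable_fun setT f ->
    measurable_fun (`[0%R, 1%R[%classic : set R) f by exact: measurable_funTS.
have a0 j M x : (0 <= a j M x)%E by rewrite aE.
pose s j x := limn (fun M => a j M x).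
have acvg j x : a j M x @[M --> \oo] --> s j x.
  by apply: ereal_nondecreasing_is_cvgn; exact: nda.
have ms j : measurable_fun setT (s j) by apply: emeasurable_fun_cvg => // x _; exact: acvg.
have s0 j x : (0 <= s j x)%E by apply: lime_ge; [exact: acvg|exact: nearW].
have sP j x : s j x = P (\bigcup_M H_ j x M).
  apply: cvg_lim => //; under eq_fun do rewrite aE.
  by apply: nondecreasing_cvg_mu => //; exact: bigcupT_measurable.
have ints j : (\int[mu]_(x in `[0%R, 1%R[) s j x <= (j.+1%:R^-1)%:E)%E.
  rewrite monotone_convergence //.
  - apply: lime_le; last by apply: nearW => M; exact: HM1.
    apply: ereal_nondecreasing_is_cvgn => M M' MM'.
    apply: ge0_le_integral => //; [exact: mTS|exact: mTS|].
    by move=> x _; exact: nda.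
  - by move=> M; exact: mTS.
pose e x := einfs (s^~ x) 0.
have me : measurable_fun setT e by exact: measurable_fun_einfs.
have e0 x : (0 <= e x)%E by apply: le_ereal_inf_tmp => _ [j _ <-].
have es x j : (e x <= s j x)%E by apply: ereal_inf_lbound; exists j.
have inte : (\int[mu]_(x in `[0%R, 1%R[) `|e x| = 0)%E.
  under eq_integral do rewrite gee0_abs //.
  apply/eqP; rewrite eq_le integral_ge0 // andbT; apply/lee_addgt0Pr => eps eps0.
  have half01 : 0 <= (2^-1 : R) < 1 by apply/andP; split; lra.
  rewrite add0e; have [j je] := expr_lt_eps half01 eps0.
  apply: (@le_trans _ _ (\int[mu]_(x in `[0%R, 1%R[) s (2 ^ j)%N x)%E).
    by apply: ge0_le_integral => //; exact: mTS.
  apply: le_trans (ints _) _; rewrite lee_fin; apply: le_trans (ltW je).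
  by rewrite exprVn lef_pV2 ?posrE ?exprn_gt0 // -natrX ler_nat.
have : ae_eq mu (`[0%R, 1%R[%classic : set R) e (cst 0%E).
  by apply/ae_eq_integral_abs => //; exact: mTS.
apply: filterS => x /[swap] x01 /(_ x01) /= ex0.
have mE n : measurable [set o | cnt w c n (x + (V n o)%:R) <= B ^+ n].
  exact: (measurable_prefix_set (fun y => cnt w c n y <= B ^+ n)).
have E0 : P (lim_sup_set (fun n => [set o | cnt w c n (x + (V n o)%:R) <= B ^+ n])) = 0%E.
  apply/eqP; rewrite -measure_le0 -ex0; apply: le_ereal_inf_tmp => _ [j _ <-].
  rewrite sP; apply: le_trans (lim_sup_set_ub P (M1 j) mE) _.
  rewrite le_measure ?inE //.
  - exact: bigcup_measurable.
  - exact: bigcupT_measurable.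
  move=> o [n /= M1n cn]; exists n => //; apply/goodP; exists n => //.
  by rewrite M1n leqnn.
apply: filterS (ae_eventually mE E0) => o [N HN]; exists N => n Nn.
by rewrite ltNge; apply/negP; exact: HN.
Qed.

End almost_sure_counts.

(** * Local dimensions *)

Section growth_rate.
Variable R : realType.
Implicit Types (a g lo hi c : R) (u v : nat -> R) (n p : nat).

(** For u >= 0 and a > 0 this says that u_n^(1/n) tends to a, without taking roots or logarithms of
    a possibly zero u_n. *)
Definition rate_is u a :=
  (forall lo, 0 < lo < a -> exists N, forall n, (N <= n)%N -> lo ^+ n <= u n) /\
  (forall hi, a < hi -> exists N, forall n, (N <= n)%N -> u n <= hi ^+ n).

Lemma expr_absorb c lo hi : 0 < c -> 0 < lo < hi ->
  exists N, forall n, (N <= n)%N -> lo ^+ n <= c * hi ^+ n.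
Proof.
move=> c0 /andP[lo0 lohi]; have hi0 : 0 < hi by exact: lt_trans lohi.
have q01 : 0 <= lo / hi < 1.
  by rewrite divr_ge0 ?(ltW lo0) ?(ltW hi0) //= ltr_pdivrMr // mul1r.
have [N Nc] := expr_lt_eps q01 c0; exists N => n Nn.
rewrite -ler_pdivrMr ?exprn_gt0 // -expr_div_n; apply: le_trans (ltW Nc).
by case/andP: q01 => q0 /ltW q1; rewrite ler_wiXn2l.
Qed.

Lemma rate_isP u a : 0 < a -> rate_is u a <-> forall k : nat,
  (exists N, forall n, (N <= n)%N -> (a * (k.+1%:R / k.+2%:R)) ^+ n <= u n) /\
  (exists N, forall n, (N <= n)%N -> u n <= (a + k.+1%:R^-1) ^+ n).
Proof.
move=> a0; split => [[u1 u2] k|u12].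
  split; [apply: u1|apply: u2]; last by rewrite ltrDl invr_gt0.
  rewrite mulr_gt0 ?divr_gt0 //= gtr_pMr // ltr_pdivrMr // mul1r ltr_nat //.
split => [lo /andP[lo0 loa]|hi ahi].
  have e0 : 0 < 1 - lo / a by rewrite subr_gt0 ltr_pdivrMr // mul1r.
  have [k kP] : exists k : nat, k.+2%:R^-1 <= 1 - lo / a.
    pose k := Num.trunc (1 - lo / a)^-1; exists k.
    rewrite invf_ple ?posrE //; apply: ltW; apply: lt_trans (truncnS_gt _) _.
    by rewrite ltr_nat.
  have [[N HN] _] := u12 k; exists N => n /HN; apply: le_trans.
  have lok : lo <= a * (k.+1%:R / k.+2%:R).
    rewrite mulrC -ler_pdivrMr //.
    have -> : k.+1%:R / k.+2%:R = 1 - k.+2%:R^-1 :> R.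
      by rewrite -[k.+1%:R](addrK 1) natr1 mulrBl mul1r divff // pnatr_eq0.
    by rewrite lerBrDr addrC -lerBrDr.
  by rewrite lerXn2r ?nnegrE ?(ltW lo0) // (le_trans (ltW lo0)).
have e0 : 0 < hi - a by rewrite subr_gt0.
pose k := Num.trunc (hi - a)^-1.
have kP : k.+1%:R^-1 <= hi - a.
  by rewrite invf_ple ?posrE //; apply: ltW; exact: truncnS_gt.
have [_ [N HN]] := u12 k; exists N => n /HN /le_trans; apply.
have hi0 : 0 < hi by exact: lt_trans ahi.
have ahik : a + k.+1%:R^-1 <= hi by rewrite -lerBrDl.
by rewrite lerXn2r ?nnegrE ?addr_ge0 ?invr_ge0 ?(ltW a0) ?(ltW hi0).
Qed.

Lemma rate_is_shift u v a g c1 c2 p N0 : 0 < g -> 0 < a -> 0 < c1 -> 0 < c2 ->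
  (forall n, (N0 <= n)%N -> c1 * g ^+ n * u (n + p)%N <= v n) ->
  (forall n, (N0 <= n)%N -> v n <= c2 * g ^+ n * u (n - p)%N) ->
  rate_is u a -> rate_is v (g * a).
Proof.
move=> g0 a0 c10 c20 vlo vhi [ulo uhi]; split => [lo /andP[lo0 loa]|hi ahi].
  have log : lo / g < a by rewrite ltr_pdivrMr // mulrC.
  have [m1 m2] := midf_lt log; set lo' := (_ + a) / 2 in m1 m2.
  have lg0 : 0 < lo / g by rewrite divr_gt0.
  have lo'0 : 0 < lo' by exact: lt_trans m1.
  have [|N1 HN1] := ulo lo'; first by rewrite lo'0.
  have [||N2 HN2] := @expr_absorb (c1 * lo' ^+ p) (lo / g) lo'.
  - by rewrite mulr_gt0 ?exprn_gt0.
  - by rewrite lg0.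
  exists (N0 + N1 + N2)%N => n Nn.
  have [Nn0 Nn1 Nn2] : [/\ N0 <= n, N1 <= n + p & N2 <= n]%N.
    by move: Nn; clear => Nn; split; lia.
  apply: le_trans (vlo n Nn0).
  have -> : lo ^+ n = (lo / g) ^+ n * g ^+ n by rewrite -exprMn divfK ?gt_eqF.
  rewrite mulrAC ler_pM2r ?exprn_gt0 //; apply: le_trans (HN2 n Nn2) _.
  by rewrite -mulrA ler_pM2l // -exprD addnC HN1.
have hig : a < hi / g by rewrite ltr_pdivlMr // mulrC.
have [m1 m2] := midf_lt hig; set hi' := (a + _) / 2 in m1 m2.
have hi'0 : 0 < hi' by exact: lt_trans m1.
have [N1 HN1] := uhi _ m1.
have [||N2 HN2] := @expr_absorb (hi' ^+ p / c2) hi' (hi / g).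
- by rewrite divr_gt0 ?exprn_gt0.
- by rewrite hi'0.
exists (N0 + N1 + N2 + p)%N => n Nn.
have [Nn0 Nn1 Nn2 pn] : [/\ N0 <= n, N1 <= n - p, N2 <= n & p <= n]%N.
  by move: Nn; clear => Nn; split; lia.
apply: le_trans (vhi n Nn0) _.
have -> : hi ^+ n = (hi / g) ^+ n * g ^+ n by rewrite -exprMn divfK ?gt_eqF.
rewrite mulrAC ler_pM2r ?exprn_gt0 //.
apply: (@le_trans _ _ (c2 * hi' ^+ (n - p))).
  by rewrite ler_pM2l // HN1.
have := HN2 n Nn2; rewrite mulrAC ler_pdivlMr // => h.
rewrite -(ler_pM2l (exprn_gt0 p hi'0)) mulrCA -exprD subnKC //.
by rewrite mulrC.
Qed.

(** Monotonicity sandwiches a radius r between g^(n+1) and g^n; replacing n by n + 1 costs a bounded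
    amount, negligible against |ln r|. *)
Lemma rate_local_dim (m : R -> R) a g : 0 < g < 1 -> 0 < a ->
  (forall r r', 0 < r -> r <= r' -> m r <= m r') ->
  rate_is (fun n => m (g ^+ n)) a ->
  (fun r => ln (m r) / ln r) @ 0^'+ --> ln a / ln g.
Proof.
move=> /andP[g0 g1] a0 mm [mlo mhi].
have [G GE] : exists G, G = - ln g by eexists.
have G0 : 0 < G by rewrite GE oppr_gt0 ln_lt0 // g0.
pose A := ln a.
apply/cvgrPdist_le => eps eps0.
pose del := eps * G / 2; have del0 : 0 < del by rewrite divr_gt0 // mulr_gt0.
have [|N1 HN1] := mlo (a * expR (- del)).
  by rewrite mulr_gt0 ?expR_gt0 //= gtr_pMr // expR_lt1 oppr_lt0.
have [|N2 HN2] := mhi (a * expR del); first by rewrite ltr_pMr // expR_gt1.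
(* For t = ln r / ln g above t0, the integer part of t is at least N1 + N2 and the bounded error |A|
   + del is at most t * del. *)
pose t0 := (N1 + N2).+1%:R + (`|A| + del) / (eps * G / 2).
near=> r.
have r0 : 0 < r by near: r; exact: nbhs_right_gt.
have rt0 : r < expR (- (t0 * G)) by near: r; apply: nbhs_right_lt; exact: expR_gt0.
have [T TE] : exists T, T = - ln r by eexists.
have Tt0 : t0 * G < T.
  by rewrite TE ltrNr -ltr_expR lnK ?posrE.
pose t := T / G; have tt0 : t0 < t by rewrite ltr_pdivlMr.
have N0le : 0 <= (`|A| + del) / (eps * G / 2).
  by rewrite divr_ge0 ?addr_ge0 ?(ltW del0) // !mulr_ge0 ?(ltW eps0) ?(ltW G0).
have t_ge : (N1 + N2).+1%:R <= t by rewrite (le_trans _ (ltW tt0)) // lerDl.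
have t_pos : 0 < t by apply: lt_le_trans t_ge.
have T_pos : 0 < T by rewrite -(divfK (lt0r_neq0 G0) T) mulr_gt0.
pose n := Num.trunc t.
have /andP[nt tn] := truncn_itv (ltW t_pos); rewrite -/n in nt tn.
have Nn : (N1 + N2 <= n)%N by rewrite truncn_ge_nat ?(ltW t_pos) // (le_trans _ t_ge) // ler_nat.
have gX k : ln (g ^+ k) = - (k%:R * G).
  by rewrite lnXn // GE mulrN opprK mulr_natl.
have rg : r <= g ^+ n.
  rewrite -ler_ln ?posrE ?exprn_gt0 // gX lerNr -TE.
  by rewrite -ler_pdivlMr.
have gr : g ^+ n.+1 <= r.
  rewrite -ler_ln ?posrE ?exprn_gt0 // gX lerNl -TE.
  by rewrite -ler_pdivrMr // ltW.
have m1 : (a * expR (- del)) ^+ n.+1 <= m r.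
  apply: le_trans (HN1 n.+1 _) (mm _ _ _ gr); last by rewrite exprn_gt0.
  exact: leqW (leq_trans (leq_addr _ _) Nn).
have m2 : m r <= (a * expR del) ^+ n.
  by apply: le_trans (mm _ _ r0 rg) (HN2 n _); exact: leq_trans (leq_addl _ _) Nn.
have m0 : 0 < m r by apply: lt_le_trans m1; rewrite exprn_gt0 // mulr_gt0 ?expR_gt0.
pose X := ln (m r).
have X1 : n.+1%:R * (A - del) <= X.
  move: m1; rewrite -ler_ln ?posrE ?exprn_gt0 ?mulr_gt0 ?expR_gt0 //.
  by rewrite lnXn ?mulr_gt0 ?expR_gt0 // lnM ?posrE ?expR_gt0 // expRK mulr_natl.
have X2 : X <= n%:R * (A + del).
  move: m2; rewrite -ler_ln ?posrE ?exprn_gt0 ?mulr_gt0 ?expR_gt0 //.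
  by rewrite lnXn ?mulr_gt0 ?expR_gt0 // lnM ?posrE ?expR_gt0 // expRK mulr_natl.
have lr : ln r = - T by rewrite TE opprK.
have lg : ln g = - G by rewrite GE opprK.
have -> : ln a / ln g - ln (m r) / ln r = (X - A * t) / T.
  rewrite lr lg !invrN !mulrN opprK [LHS]addrC mulrBl; congr (_ - _).
  by rewrite /t -mulrA [T / G / T]mulrAC divff ?mul1r // lt0r_neq0.
rewrite normrM [`|T^-1|]ger0_norm ?invr_ge0 ?(ltW T_pos) // ler_pdivrMr //.
have main : `|A| + del <= t * del.
  have : (`|A| + del) / (eps * G / 2) <= t.
    by apply: ltW; apply: le_lt_trans tt0; rewrite lerDr.
  by rewrite ler_pdivrMr // -/del.
have -> : eps * T = 2 * (t * del).
  have -> : T = t * G by rewrite /t divfK // lt0r_neq0.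
  by rewrite /del; clear; lra.
have A1 : A * (n%:R - t) <= `|A|.
  apply: le_trans (ler_norm _) _; rewrite normrM ler_piMr //.
  by rewrite ler_norml; move: tn; rewrite -natr1; lra.
have A2 : - `|A| <= A * (n.+1%:R - t).
  rewrite lerNl; apply: le_trans (ler_norm _) _; rewrite normrN normrM ler_piMr //.
  by rewrite ler_norml; move: tn; rewrite -natr1; lra.
have ndel : n%:R * del <= t * del by rewrite ler_wpM2r // ltW.
have e1 : n%:R * (A + del) - A * t = A * (n%:R - t) + n%:R * del by ring.
have e2 : n.+1%:R * (A - del) - A * t = A * (n.+1%:R - t) - n%:R * del - del.
  by rewrite -natr1; ring.
rewrite ler_norml; apply/andP; split.
  apply: (@le_trans _ _ (n.+1%:R * (A - del) - A * t)); last by rewrite lerD2r.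
  rewrite e2; move: A2 ndel main.
  by move: (A * _) (n%:R * del) (t * del) => ? ? ?; clear; lra.
apply: (@le_trans _ _ (n%:R * (A + del) - A * t)); first by rewrite lerD2r.
rewrite e1; move: A1 ndel main del0.
by move: (A * _) (n%:R * del) (t * del) => ? ? ?; clear; lra.
Unshelve. all: by end_near. Qed.

End growth_rate.

(** * Mass of balls in the fibres *)

Section ball_mass.
Variables (R : realType) (w : skew_data R).
Local Notation b := (base w).
Local Notation gamma := (rate w).
Local Notation D := (tail_bound w).
Local Notation mu := (@lebesgue_measure R).
Variables (d : measure_display) (Omega : measurableType d).
Variables (P : probability Omega R) (J : nat -> Omega -> nat).
Hypothesis J_iid : iid_uniform_digits P b J.
Local Notation V := (prefix_value b J).
Implicit Types (x y c r : R) (o : Omega) (n p : nat).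

Let b0 := base_gt0 w.

Definition skew_sum x o : R := Sfun b gamma (forcing w) x (fun k => J k o).

(** By conversion, [m_meas] of a ball. Measurability is needed jointly in x and y, for the
    exceptional set of omega. *)
Definition mass x y r : \bar R := P [set o | ball y r (skew_sum x o)].

Lemma measurable_prefixr n : measurable_fun setT (fun o => (V n o)%:R : R).
Proof.
move=> _ Y mY; rewrite setTI.
rewrite (_ : _ @^-1` _ = [set o | `[< Y (V n o)%:R >] ]); last first.
  by apply/seteqP; split => o /= /asboolP.
exact: (measurable_prefix b0 J_iid n (fun v => `[< Y v%:R >])).
Qed.

Lemma measurable_skew_sum2 : measurable_fun setT (fun q : R * Omega => skew_sum q.1 q.2).
Proof.
apply: (measurable_fun_cvg (h := fun n (q : R * Omega) => partS w n (q.1 + (V n q.2)%:R))).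
  move=> n; apply: (measurableT_comp (measurable_partS w n)).
  apply: measurable_funD; first exact: measurable_fst.
  exact: (measurableT_comp (measurable_prefixr n) measurable_snd).
by move=> q _; exact: Sfun_cvg.
Qed.

Lemma measurable_skew_sum x : measurable_fun setT (skew_sum x).
Proof. exact: (measurable_fun_pair2 x measurable_skew_sum2). Qed.

Lemma measurable_ball_event x y r : measurable [set o | ball y r (skew_sum x o)].
Proof.
by rewrite -[X in measurable X]setTI; apply: measurable_skew_sum => //; exact: measurable_ball.
Qed.

Lemma measurable_mass r : measurable_fun setT (fun q : R * R => mass q.1 q.2 r).
Proof.
pose A := [set q : (R * R) * Omega | `|q.1.2 - skew_sum q.1.1 q.2| < r].
have mA : measurable A.
  have mg : measurable_fun setT (fun q : (R * R) * Omega => (q.1.1, q.2)).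
    apply: measurable_fun_pair => //.
    exact: (measurableT_comp measurable_fst measurable_fst).
  pose f (q : (R * R) * Omega) := `|q.1.2 - skew_sum q.1.1 q.2|.
  have mf : measurable_fun setT f.
    apply: measurableT_comp => //; apply: measurable_funB.
      exact: (measurableT_comp measurable_snd measurable_fst).
    exact: (measurableT_comp measurable_skew_sum2 mg).
  rewrite (_ : A = f @^-1` `]-oo, r[%classic); first by rewrite -[X in measurable X]setTI; exact: mf.
  by apply/seteqP; split => q /=; rewrite in_itv.
have := measurable_fun_xsection P mA.
congr measurable_fun; apply/funext => q; rewrite /mass /=; congr (P _).
by apply/seteqP; split => o; rewrite /xsection /= inE.
Qed.

Lemma mass_fin x y r : mass x y r \is a fin_num.
Proof. by rewrite fin_num_measure //; exact: measurable_ball_event. Qed.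

Lemma mass_le x x' y y' r r' : (forall o, ball y r (skew_sum x o) -> ball y' r' (skew_sum x' o)) ->
  (mass x y r <= mass x' y' r')%E.
Proof. by move=> h; rewrite le_measure ?inE; [|exact: measurable_ball_event|exact: measurable_ball_event|]. Qed.

Let close_law c n x o : P [set o' | partS_close w c n (x + (V n o')%:R) (x + (V n o)%:R)] =
  ((b%:R ^+ n)^-1 * cnt w c n (x + (V n o)%:R))%:E.
Proof.
rewrite (prefix_law b0 J_iid n (fun y => partS_close w c n y (x + (V n o)%:R))).
by rewrite /avg cnt_shift.
Qed.

Let closeP c n x (v : R) : measurable [set o' | partS_close w c n (x + (V n o')%:R) v].
Proof. exact: (measurable_prefix_set J_iid (fun y => partS_close w c n y v)). Qed.

(** Each of the two sums is within D gamma^n of its n-th partial sum, whence [c_out] = 1 + 2 D. *)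
Lemma mass_le_cnt x n o :
  (mass x (skew_sum x o) (gamma ^+ n) <=
     ((b%:R ^+ n)^-1 * cnt w (c_out w) n (x + (V n o)%:R))%:E)%E.
Proof.
rewrite -close_law le_measure ?inE //; first exact: measurable_ball_event.
move=> o' /=; rewrite /ball /= => hb; rewrite /partS_close.
have h1 := Sfun_tail w x (fun k => J k o) n; have h2 := Sfun_tail w x (fun k => J k o') n.
set s := partS _ _ _; set t := partS _ _ _.
have -> : s - t = (skew_sum x o - t) - (skew_sum x o' - s) - (skew_sum x o - skew_sum x o') by ring.
apply: le_trans (ler_normB _ _) _; rewrite /c_out mulrDl mul1r addrC; apply: lerD; first exact: ltW.
apply: le_trans (ler_normB _ _) _.
by rewrite mulr2n mulrDl mul1r mulrDl; exact: lerD.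
Qed.

(** With p more digits, closeness with constant c and the two tails together stay below gamma^n. *)
Lemma cnt_le_mass x n p c o : (c + 2 * D) * gamma ^+ p < 1 ->
  (((b%:R ^+ (n + p))^-1 * cnt w c (n + p) (x + (V (n + p) o)%:R))%:E <=
     mass x (skew_sum x o) (gamma ^+ n))%E.
Proof.
move=> cp; rewrite -close_law le_measure ?inE //; first exact: measurable_ball_event.
move=> o' /=; rewrite /partS_close /ball /= => hc.
have h1 := Sfun_tail w x (fun k => J k o) (n + p); have h2 := Sfun_tail w x (fun k => J k o') (n + p).
set s := partS _ _ _ in hc; set t := partS _ _ _ in hc.
have -> : skew_sum x o - skew_sum x o' = (skew_sum x o - t) - (skew_sum x o' - s) - (s - t) by ring.
apply: (@le_lt_trans _ _ ((c + 2 * D) * gamma ^+ p * gamma ^+ n)); last first.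
  by rewrite gtr_pMl ?rateX_gt0.
rewrite -mulrA -exprD [(p + n)%N]addnC.
apply: le_trans (ler_normB _ _) _; rewrite mulrDl addrC; apply: lerD => //.
apply: le_trans (ler_normB _ _) _.
have -> : 2 * D * gamma ^+ (n + p) = D * gamma ^+ (n + p) + D * gamma ^+ (n + p) by ring.
exact: lerD.
Qed.

Lemma as_rate : exists a : R, [/\ gamma <= a, a <= 1 &
  {ae mu, forall x, (`[0%R, 1%R[%classic : set R) x ->
    {ae P, forall o, rate_is (fun n => fine (mass x (skew_sum x o) (gamma ^+ n))) a}}].
Proof.
have bR : 0 < (b%:R : R) by rewrite ltr0n.
have [betas [bg bb up low]] := count_growth w.
have [a aE] : exists a : R, a = betas / b%:R by eexists.
have ga : gamma <= a by rewrite aE ler_pdivlMr // mulrC.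
have a0 : 0 < a by apply: lt_le_trans (rate_gt0 w) ga.
have a1 : a <= 1 by rewrite aE ler_pdivrMr // mul1r.
exists a; split => //.
have baE : b%:R * a = betas by rewrite aE mulrC divfK ?gt_eqF.
have [p pP] : exists p, gamma ^+ p < (c_blk w + 1 + 2 * D + 1)^-1.
  apply: expr_lt_eps; first by rewrite (ltW (rate_gt0 w)) rate_lt1.
  by rewrite invr_gt0; have := c_blk_ge0 w; have := tail_bound_ge0 w; lra.
have {}pP : (c_blk w + 1 + 2 * D) * gamma ^+ p < 1.
  have C0 : 0 < c_blk w + 1 + 2 * D + 1 by have := c_blk_ge0 w; have := tail_bound_ge0 w; lra.
  move: pP; rewrite -(ltr_pM2l C0) mulfV ?gt_eqF //; apply: le_lt_trans.
  by rewrite ler_wpM2r ?(ltW (rateX_gt0 w p)) // lerDl.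
pose lo k : R := a * (k.+1%:R / k.+2%:R).
have lo0 k : 0 < lo k by rewrite mulr_gt0 ?divr_gt0.
have loa k : lo k < a by rewrite gtr_pMr // ltr_pdivrMr // mul1r ltr_nat.
pose hi k : R := a + k.+1%:R^-1.
have hia k : a < hi k by rewrite ltrDl invr_gt0.
have hi0 k : 0 < hi k by exact: lt_trans (hia k).
have ae_low : {ae mu, forall x, forall k, (`[0%R, 1%R[%classic : set R) x ->
    {ae P, forall o, exists N, forall n, (N <= n)%N ->
       (b%:R * lo k) ^+ n < cnt w (c_blk w + 1) n (x + (V n o)%:R)}}.
  apply: ae_foralln => k; apply: (as_count_gt J_iid) => eps eps0; apply: low => //.
    by rewrite mulr_gt0.
  by rewrite -baE ltr_pM2l.
apply: (@filterS _ _ (ae_filter_ringOfSetsType mu) _ _ _ ae_low) => x xlow x01.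
have x01' : 0 <= x <= 1.
  by move: x01; rewrite /= in_itv /= => /andP[-> /ltW].
have ae_up : {ae P, forall o, forall k, exists N, forall n, (N <= n)%N ->
    cnt w (c_out w) n (x + (V n o)%:R) <= (b%:R * hi k) ^+ n}.
  apply: ae_foralln => k; have [|C [th [C0 th0 th1 H]]] := up (b%:R * hi k).
    by rewrite -baE ltr_pM2l.
  by apply: (as_count_le J_iid C0 th0 th1 x01') => N; exact: H.
have ae_lowx : {ae P, forall o, forall k, exists N, forall n, (N <= n)%N ->
       (b%:R * lo k) ^+ n < cnt w (c_blk w + 1) n (x + (V n o)%:R)}.
  by apply: ae_foralln => k; exact: xlow.
apply: filterS2 ae_up ae_lowx => o oup olow.
apply/rate_isP => // k; split; last first.
  have [N HN] := oup k; exists N => n Nn.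
  rewrite -lee_fin fineK ?mass_fin //; apply: le_trans (mass_le_cnt x n o) _.
  by rewrite lee_fin ler_pdivrMl ?baseX_gt0 // -exprMn HN.
(* The p extra digits cost a constant factor, absorbed by passing from [lo k.+1] to [lo k]. *)
have lokk : 0 < lo k < lo k.+1.
  rewrite lo0 /= ltr_pM2l // ltr_pdivrMr // mulrAC ltr_pdivlMr //.
  by rewrite -!natrM ltr_nat; clear; lia.
have [N1 HN1] := @expr_absorb _ (lo k.+1 ^+ p) _ _ (exprn_gt0 p (lo0 k.+1)) lokk.
have [N HN] := olow k.+1; exists (N + N1)%N => n Nn.
have [Nn1 Nn2] : (N <= n + p)%N /\ (N1 <= n)%N by move: Nn; clear => Nn; split; lia.
apply: le_trans (HN1 n Nn2) _; rewrite -exprD addnC.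
rewrite -lee_fin fineK ?mass_fin //; apply: le_trans (cnt_le_mass x n o pP).
rewrite lee_fin ler_pdivlMl ?baseX_gt0 // -exprMn ltW //; exact: HN.
Qed.

End ball_mass.

(** * Mass of balls in the plane and conclusion *)

Section skew_measure.
Variables (R : realType) (w : skew_data R).
Local Notation b := (base w).
Local Notation gamma := (rate w).
Local Notation Lam := (forcing_lip w).
Local Notation mu := (@lebesgue_measure R).
Variables (d : measure_display) (Omega : measurableType d).
Variables (P : probability Omega R) (J : nat -> Omega -> nat).
Hypothesis J_iid : iid_uniform_digits P b J.
Local Notation S := (skew_sum w J).
Local Notation mass := (mass w P J).
Implicit Types (x y a r : R) (o : Omega) (n p : nat).

Let section_mass (z : R * R) r x := P [set o | ball z r (x, S x o)].

Definition skew_mass (z : R * R) r : \bar R :=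
  (\int[mu]_(x in `[0%R, 1%R[) section_mass z r x)%E.

Let section_massE z r x :
  section_mass z r x = if `|z.1 - x| < r then mass x z.2 r else 0%E.
Proof.
rewrite /section_mass; case: ifPn => h.
  by congr (P _); apply/seteqP; split => o /=; [case|split].
rewrite (_ : [set _ | _] = set0) ?measure0 //; apply/seteqP; split => // o [/=].
by rewrite /ball /= (negbTE h).
Qed.

Let section_mass_event z r : measurable [set q : R * Omega | ball z r (q.1, S q.1 q.2)].
Proof.
rewrite (_ : [set _ | _] = (fst @^-1` ball z.1 r) `&`
    ((fun q : R * Omega => S q.1 q.2) @^-1` ball z.2 r)); last first.
  by apply/seteqP; split => q /=.
apply: measurableI.
  by rewrite -[X in measurable X]setTI; apply: measurable_fst => //; exact: measurable_ball.
rewrite -[X in measurable X]setTI; apply: (measurable_skew_sum2 J_iid) => //.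
exact: measurable_ball.
Qed.

Let measurable_section_mass z r : measurable_fun setT (section_mass z r).
Proof.
have := measurable_fun_xsection P (section_mass_event z r).
congr measurable_fun; apply/funext => x; congr (P _).
by apply/seteqP; split => o; rewrite /xsection /= inE.
Qed.

Let mTS (f : R -> \bar R) : measurable_fun setT f ->
  measurable_fun (`[0%R, 1%R[%classic : set R) f.
Proof. exact: measurable_funTS. Qed.

Lemma skew_mass_fin z r : skew_mass z r \is a fin_num.
Proof.
rewrite ge0_fin_numE ?integral_ge0 //; apply: le_lt_trans (ltry 1).
apply: (@le_trans _ _ (\int[mu]_(x in `[0%R, 1%R[) 1%:E)%E).
  apply: ge0_le_integral => //; first exact: mTS (measurable_section_mass _ _).
  move=> x _; rewrite section_massE; case: ifP => _; rewrite ?lee_fin //.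
  by apply: probability_le1; exact: (measurable_ball_event J_iid).
by rewrite integral_cst //= lebesgue_measure_itv /= lte_fin ltr01 oppr0 adde0 mule1.
Qed.

Lemma skew_mass_mono z r r' : r <= r' -> (skew_mass z r <= skew_mass z r')%E.
Proof.
move=> rr'; apply: ge0_le_integral => //; [exact: mTS (measurable_section_mass _ _)|exact: mTS (measurable_section_mass _ _)|move=> x _].
rewrite !section_massE; case: ifPn => [h|_]; last by case: ifP.
rewrite (lt_le_trans h rr'); apply: (mass_le J_iid) => o.
by rewrite /ball /= => h'; exact: lt_le_trans rr'.
Qed.

Let integral_indicator_itv (c : R) (u v : R) : 0 <= c -> u <= v ->
  (\int[mu]_(x in `[0%R, 1%R[) (c * \1_(`]u, v[%classic : set R) x)%:E <= (c * (v - u))%:E)%E.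
Proof.
move=> c0 uv; under eq_integral do rewrite EFinM.
rewrite ge0_integralZl_EFin //; last exact/measurable_EFinP/measurable_indic.
rewrite integral_indic // EFinM; apply: lee_wpmul2l; first by rewrite lee_fin.
apply: (@le_trans _ _ (mu (`]u, v[%classic : set R))).
  by apply: le_measure; rewrite ?inE //; apply: measurableI.
rewrite lebesgue_measure_itv /= lte_fin; case: ifP => _; first by rewrite EFinB.
by rewrite lee_fin subr_ge0.
Qed.

Let integral_indicator_itv_sub (c : R) (u v : R) : 0 <= c -> 0 <= u -> u <= v -> v <= 1 ->
  (\int[mu]_(x in `[0%R, 1%R[) (c * \1_(`]u, v[%classic : set R) x)%:E = (c * (v - u))%:E)%E.
Proof.
move=> c0 u0 uv v1; under eq_integral do rewrite EFinM.
rewrite ge0_integralZl_EFin //; last exact/measurable_EFinP/measurable_indic.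
rewrite integral_indic // setIidl; last first.
  by move=> x /=; rewrite !in_itv /= => /andP[h1 h2]; apply/andP; split; lra.
rewrite EFinM; congr (_ * _)%E; apply: (eq_trans (lebesgue_measure_itv `]u, v[)).
rewrite /= lte_fin.
by case: ltgtP uv => // -> _; rewrite subrr.
Qed.

(** Only fibres over |x' - x| < gamma^n meet the ball, and moving S from x' to x enlarges the radius
    to at most (1 + Lam) gamma^n <= gamma^(n - p). *)
Lemma skew_mass_le x y n p : (p <= n)%N -> (1 + Lam) * gamma ^+ p <= 1 ->
  (skew_mass (x, y) (gamma ^+ n) <=
     (2 * gamma ^+ n * fine (mass x y (gamma ^+ (n - p))))%:E)%E.
Proof.
move=> pn hp; set c := fine _.
have c0 : 0 <= c by rewrite fine_ge0.
have g0 := rateX_gt0 w n.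
apply: (@le_trans _ _ (\int[mu]_(x' in `[0%R, 1%R[)
   (c * \1_(`]x - gamma ^+ n, x + gamma ^+ n[%classic : set R) x')%:E)%E); last first.
  apply: le_trans (integral_indicator_itv c0 _) _; first by lra.
  by rewrite lee_fin le_eqVlt; apply/orP; left; apply/eqP; ring.
apply: ge0_le_integral => //.
- exact: mTS (measurable_section_mass _ _).
- apply: mTS; apply/measurable_EFinP; apply: measurable_funM => //.
move=> x' _; rewrite section_massE /=; case: ifPn => h; last first.
  by rewrite lee_fin mulr_ge0.
rewrite indicE mem_set /= ?mulr1; last first.
  by rewrite in_itv /=; move: h; rewrite ltr_distlC => /andP[h1 h2]; lra.
rewrite /c fineK ?(mass_fin J_iid) //; apply: (mass_le J_iid) => o.
rewrite /ball /= => hb.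
have -> : y - S x o = (y - S x' o) + (S x' o - S x o) by ring.
apply: le_lt_trans (ler_normD _ _) _.
have SL : `|S x' o - S x o| <= Lam * gamma ^+ n.
  apply: le_trans (Sfun_lip _ _ _ _) _; rewrite ler_wpM2l ?forcing_lip_ge0 //.
  by rewrite distrC ltW.
apply: (@lt_le_trans _ _ ((1 + Lam) * gamma ^+ n)).
  by rewrite mulrDl mul1r; exact: ltr_leD.
rewrite -{1}(subnK pn) exprD mulrCA ler_piMr //; exact/ltW/rateX_gt0.
Qed.

(** Over the narrower strip |x' - x| < gamma^(n + p), points within gamma^(n + p) of y stay within
    gamma^n after moving the fibre. The strip lies in [0, 1], hence has full width. *)
Lemma skew_mass_ge x y n p : (1 + Lam) * gamma ^+ p <= 1 ->
  gamma ^+ n <= x -> x + gamma ^+ n <= 1 ->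
  ((2 * gamma ^+ p * gamma ^+ n * fine (mass x y (gamma ^+ (n + p))))%:E <=
    skew_mass (x, y) (gamma ^+ n))%E.
Proof.
move=> hp xn xn1; set c := fine _.
have c0 : 0 <= c by rewrite fine_ge0.
have g0 := rateX_gt0 w (n + p).
have gp : gamma ^+ (n + p) <= gamma ^+ n.
  by rewrite ler_wiXn2l ?leq_addr // ltW ?rate_gt0 ?rate_lt1.
apply: (@le_trans _ _ (\int[mu]_(x' in `[0%R, 1%R[)
   (c * \1_(`]x - gamma ^+ (n + p), x + gamma ^+ (n + p)[%classic : set R) x')%:E)%E).
  rewrite integral_indicator_itv_sub //; [|lra|lra|lra].
  by rewrite lee_fin le_eqVlt; apply/orP; left; apply/eqP; rewrite exprD; ring.
apply: ge0_le_integral => //.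
- by move=> x' _; rewrite lee_fin mulr_ge0.
- apply: mTS; apply/measurable_EFinP; apply: measurable_funM => //.
- exact: mTS (measurable_section_mass _ _).
move=> x' _; rewrite indicE; have [|_] := boolP (x' \in _); last by rewrite mulr0.
rewrite inE /= in_itv /= => /andP[h1 h2]; rewrite mulr1 section_massE /=.
have xx' : `|x - x'| < gamma ^+ (n + p) by rewrite ltr_distlC; lra.
rewrite (lt_le_trans xx' gp) /c fineK ?(mass_fin J_iid) //; apply: (mass_le J_iid) => o.
rewrite /ball /= => hb.
have -> : y - S x' o = (y - S x o) + (S x o - S x' o) by ring.
apply: le_lt_trans (ler_normD _ _) _.
have SL : `|S x o - S x' o| <= Lam * gamma ^+ (n + p).
  apply: le_trans (Sfun_lip _ _ _ _) _; rewrite ler_wpM2l ?forcing_lip_ge0 //.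
  exact: ltW.
apply: (@lt_le_trans _ _ ((1 + Lam) * gamma ^+ (n + p))).
  by rewrite mulrDl mul1r; exact: ltr_leD.
by rewrite exprD mulrCA ler_piMr // ltW ?rateX_gt0.
Qed.

Lemma skew_mass_rate x y a : 0 < x < 1 -> 0 < a ->
  rate_is (fun n => fine (mass x y (gamma ^+ n))) a ->
  rate_is (fun n => fine (skew_mass (x, y) (gamma ^+ n))) (gamma * a).
Proof.
move=> /andP[x0 x1] a0 ua.
have L0 := forcing_lip_ge0 w.
have [p hp] : exists p, gamma ^+ p < (1 + Lam)^-1.
  by apply: expr_lt_eps; [rewrite (ltW (rate_gt0 w)) rate_lt1|rewrite invr_gt0; lra].
have {}hp : (1 + Lam) * gamma ^+ p <= 1.
  by rewrite -ler_pdivlMl ?mulr1 ?(ltW hp) //; lra.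
have [N hN] : exists N, gamma ^+ N < Num.min x (1 - x).
  apply: expr_lt_eps; first by rewrite (ltW (rate_gt0 w)) rate_lt1.
  by rewrite lt_min x0 subr_gt0.
have g0 := rate_gt0 w.
apply: (@rate_is_shift _ _ _ a gamma (2 * gamma ^+ p) 2 p (N + p) g0 a0 _ _ _ _ ua).
- by rewrite mulr_gt0 ?rateX_gt0.
- by [].
- move=> n Nn; rewrite -lee_fin fineK ?skew_mass_fin //.
  have gn : gamma ^+ n < Num.min x (1 - x).
    apply: le_lt_trans hN; rewrite ler_wiXn2l ?(ltW g0) ?(ltW (rate_lt1 w)) //.
    exact: leq_trans (leq_addr _ _) Nn.
  move: gn; rewrite lt_min => /andP[gn1 gn2].
  by apply: skew_mass_ge => //; [exact: ltW|lra].
move=> n Nn; rewrite -lee_fin fineK ?skew_mass_fin //.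
apply: skew_mass_le => //; exact: leq_trans (leq_addl _ _) Nn.
Qed.

Let measurable_mass_rate a : 0 < a ->
  measurable [set q : R * R | rate_is (fun n => fine (mass q.1 q.2 (gamma ^+ n))) a].
Proof.
move=> a0; pose u n (q : R * R) := fine (mass q.1 q.2 (gamma ^+ n)).
have mu_ n : measurable_fun setT (u n).
  by apply: measurableT_comp => //; exact: (measurable_mass J_iid).
pose A k n := [set q | (a * (k.+1%:R / k.+2%:R)) ^+ n <= u n q].
pose B k n := [set q | u n q <= (a + k.+1%:R^-1) ^+ n].
have mA k n : measurable (A k n).
  rewrite (_ : A k n = u n @^-1` `[(a * (k.+1%:R / k.+2%:R)) ^+ n, +oo[%classic).
    by rewrite -[X in measurable X]setTI; exact: mu_.
  by apply/seteqP; split => q /=; rewrite in_itv /= andbT.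
have mB k n : measurable (B k n).
  rewrite (_ : B k n = u n @^-1` `]-oo, (a + k.+1%:R^-1) ^+ n]%classic).
    by rewrite -[X in measurable X]setTI; exact: mu_.
  by apply/seteqP; split => q /=; rewrite in_itv.
rewrite (_ : [set _ | _] = \bigcap_k ((\bigcup_N \bigcap_(n in [set n | (N <= n)%N]) A k n) `&`
    (\bigcup_N \bigcap_(n in [set n | (N <= n)%N]) B k n))).
  apply: bigcapT_measurable => k; apply: measurableI; apply: bigcupT_measurable => N;
    by apply: bigcap_measurableType.
apply/seteqP; split => q /=.
  move=> /(rate_isP _ a0) h k _; have [[N HN] [N' HN']] := h k.
  by split; [exists N|exists N'].
move=> h; apply/(rate_isP _ a0) => k; have [[N _ HN] [N' _ HN']] := h k I.
by split; [exists N => n Nn; exact: HN|exists N' => n Nn; exact: HN'].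
Qed.

Lemma skew_exact_dim : exists alpha : R, 0 <= alpha <= 1 /\
  {ae mu, forall x, (`[0%R, 1%R[%classic : set R) x ->
     exact_dim_with (@measurable _ R) (m_meas P J b gamma (forcing w) x) alpha} /\
  exact_dim_with (@measurable _ (R * R)%type) (omega_meas P J b gamma (forcing w))
    (1 + alpha).
Proof.
have [a [ga a1 ae_rate]] := as_rate J_iid.
have g0 := rate_gt0 w; have g1 := rate_lt1 w.
have a0 : 0 < a by exact: lt_le_trans ga.
have lg0 : ln gamma < 0 by rewrite ln_lt0 // g0.
have lgn0 : ln gamma != 0 by rewrite lt_eqF.
exists (ln a / ln gamma); split; [|split].
- rewrite -mulrNN -invrN ler_pdivlMr ?ler_pdivrMr ?oppr_gt0 // mul0r mul1r lerN2.
  by rewrite oppr_ge0 ln_le0 //= ler_ln // posrE.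
- apply: (@filterS _ _ (ae_filter_ringOfSetsType mu) _ _ _ ae_rate) => x + x01.
  move=> /(_ x01) rate_x.
  pose G := [set y | rate_is (fun n => fine (mass x y (gamma ^+ n))) a].
  have mG : measurable G.
    have := measurable_xsection x (measurable_mass_rate a0); congr measurable.
    by apply/seteqP; split => y; rewrite /xsection /= inE.
  exists (~` G); split; first exact: measurableC; split.
    apply: measure_negligible.
      rewrite -[X in measurable X]setTI; apply: (measurable_skew_sum J_iid) => //.
      exact: measurableC.
    by case: rate_x => Z [mZ Z0 hZ]; exists Z; split => // o /= ho; apply: hZ.
  move=> y /contrapT Gy.
  apply: (rate_local_dim (m := fun r => fine (mass x y r)) _ a0) => //; first by rewrite g0.
  move=> r r' _ rr'; apply: fine_le; rewrite ?(mass_fin J_iid) //.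
  apply: (mass_le J_iid) => o; rewrite /ball /= => h; exact: lt_le_trans rr'.
(* The endpoints are excluded because [skew_mass_ge] needs a strip around x inside [0, 1]. *)
pose G := [set q : R * R | 0 < q.1 < 1 /\ rate_is (fun n => fine (mass q.1 q.2 (gamma ^+ n))) a].
have mG : measurable G.
  rewrite (_ : G = (fst @^-1` `]0, 1[%classic) `&`
     [set q : R * R | rate_is (fun n => fine (mass q.1 q.2 (gamma ^+ n))) a]).
    apply: measurableI; last exact: measurable_mass_rate.
    by rewrite -[X in measurable X]setTI; exact: measurable_fst.
  by apply/seteqP; split => q /=; rewrite in_itv.
exists (~` G); split; first exact: measurableC; split; last first.
  move=> [x y] /contrapT [/= x01 Gxy].
  (* The width of the strip multiplies the rate by gamma, which is the additional dimension 1. *)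
  have -> : 1 + ln a / ln gamma = ln (gamma * a) / ln gamma.
    by rewrite lnM ?posrE // mulrDl divff.
  apply: (rate_local_dim (m := fun r => fine (skew_mass (x, y) r))).
  - by rewrite g0.
  - by rewrite mulr_gt0.
  - by move=> r r' _ rr'; apply: fine_le; rewrite ?skew_mass_fin // skew_mass_mono.
  - exact: skew_mass_rate.
pose F x := P [set o | (~` G) (x, S x o)].
have mGS : measurable [set q : R * Omega | (~` G) (q.1, S q.1 q.2)].
  have mS : measurable_fun setT (fun q : R * Omega => (q.1, S q.1 q.2)).
    by apply: measurable_fun_pair => //; exact: (measurable_skew_sum2 J_iid).
  rewrite -[X in measurable X]setTI; apply: mS => //; exact: measurableC.
have mF : measurable_fun setT F.
  have := measurable_fun_xsection P mGS.
  congr measurable_fun; apply/funext => x; congr (P _).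
  by apply/seteqP; split => o; rewrite /xsection /= inE.
have mFx x : measurable [set o | (~` G) (x, S x o)].
  have := measurable_xsection x mGS; congr measurable.
  by apply/seteqP; split => o; rewrite /xsection /= inE.
have ae_neq0 : {ae mu, forall x : R, x != 0}.
  exists [set 0]; split => //; first exact: lebesgue_measure_set1.
  by move=> x /= /negP; rewrite negbK => /eqP.
have F0 : ae_eq mu (`[0%R, 1%R[%classic : set R) F (cst 0%E).
  apply: (@filterS2 _ _ (ae_filter_ringOfSetsType mu) _ _ _ _ ae_rate ae_neq0).
  move=> x + x0 x01 => /(_ x01) [Z [mZ Z0 hZ]].
  apply: measure_negligible; first exact: mFx.
  exists Z; split => // o /= hG; apply: hZ => /= hr; apply: hG; split => //=.
  by move: x01; rewrite /= in_itv /= => /andP[x_ge0 ->]; rewrite lt0r x0 x_ge0.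
rewrite (_ : omega_meas _ _ _ _ _ _ = \int[mu]_(x in `[0%R, 1%R[) F x)%E //.
transitivity (\int[mu]_(x in `[0%R, 1%R[) (cst 0 x : \bar R))%E; last exact: integral0.
by apply: ae_eq_integral => //; exact: mTS.
Qed.

End skew_measure.

Section periodic_lipschitz.
Variables (R : realType) (phi : R -> R).
Hypothesis phi_per : Zperiodic phi.

Lemma lipschitz_bound : lipschitz phi -> exists L : R,
  forall x y, `|phi x - phi y| <= L * `|x - y|.
Proof.
(* [lipschitz] gives the inequality for constants strictly above M0. *)
move=> [M0 [_ hM]]; exists (M0 + 1) => x y.
have M01 : M0 < M0 + 1 by rewrite ltrDl.
by have /= := hM (M0 + 1) M01 (x, y); apply.
Qed.

Lemma periodic_lipschitz_bounded (L : R) :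
  (forall x y, `|phi x - phi y| <= L * `|x - y|) -> forall y, `|phi y| <= `|phi 0| + `|L|.
Proof.
move=> phiL y.
have per n x : phi (x + n%:R) = phi x.
  by elim: n x => [|n IH] x; rewrite ?addr0 // -natr1 addrA phi_per.
pose n := (Num.trunc `|y|).+1; pose m := Num.trunc (y + n%:R).
have yn : 0 <= y + n%:R.
  have := truncnS_gt `|y|; rewrite -/n; have := ler_normr (- y) `|y|.
  have : - y <= `|y| by rewrite -normrN ler_norm.
  lra.
have /andP[m1 m2] := truncn_itv yn; rewrite -/m in m1 m2.
have -> : phi y = phi (y + n%:R - m%:R) by rewrite -(per n y) -(per m (_ - _)) subrK.
set z := _ - _; have z01 : `|z| <= 1.
  by rewrite ler_norml; move: m2; rewrite /z -natr1; lra.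
rewrite -[phi z](subrK (phi 0)) addrC; apply: le_trans (ler_normD _ _) _.
rewrite lerD2l; apply: le_trans (phiL _ _) _; rewrite subr0.
apply: (@le_trans _ _ (`|L| * `|z|)); first by rewrite ler_wpM2r // ler_norm.
by rewrite ler_piMr.
Qed.

End periodic_lipschitz.

Theorem theorem3p1 (R : realType) (b : nat) (gamma : R) (phi : R -> R)
  (d : measure_display) (Omega : measurableType d) (P : probability Omega R)
  (J : nat -> Omega -> nat) :
  (2 <= b)%N -> 0 < gamma < 1 -> Zperiodic phi -> lipschitz phi ->
  iid_uniform_digits P b J ->
  exact_dimensional (@measurable _ (R * R)%type) (omega_meas P J b gamma phi) /\
  exists alpha : R, 0 <= alpha <= 1 /\
    {ae (@lebesgue_measure R), forall x : R, (`[0%R, 1%R]%classic : set R) x ->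
        exact_dim_with (@measurable _ R) (m_meas P J b gamma phi x) alpha} /\
    exact_dim_with (@measurable _ (R * R)%type) (omega_meas P J b gamma phi)
      (1 + alpha).
Proof.
move=> b2 gamma01 phi_per phi_lip J_iid.
have [L phiL] := lipschitz_bound phi_lip.
pose w := SkewData b2 gamma01 phi_per (periodic_lipschitz_bounded phi_per phiL) phiL.
have [alpha [alpha01 [dim_m dim_omega]]] := @skew_exact_dim R w d Omega P J J_iid.
split; first by exists (1 + alpha).
exists alpha; split => //; split => //.
(* The fibre result was obtained on [0, 1); the endpoint 1 is a null set. *)
have ae_neq1 : {ae @lebesgue_measure R, forall x : R, x != 1}.
  exists [set 1]; split => //; first exact: lebesgue_measure_set1.
  by move=> x /= /negP; rewrite negbK => /eqP.
apply: (@filterS2 _ _ (ae_filter_ringOfSetsType _) _ _ _ _ dim_m ae_neq1).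
move=> x dim_x x1 x01; apply: dim_x; move: x01; rewrite /= !in_itv /= => /andP[-> x_le1].
by rewrite lt_neqAle x1.
Qed.
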